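(* For any field $K$ of characteristic $0$, the category $\mathbf{Hopf}_{K,coc}$ of cocommutative Hopf $K$-algebras is action representable (i.e. it has representable object actions).
   Context: $\mathbf{Hopf}_{K,coc}$ is the category of cocommutative Hopf $K$-algebras (not necessarily finite-dimensional) and $K$-bialgebra morphisms; for $K$ of characteristic $0$ it is a semi-abelian category, with zero object $K$. Let $\mathbf{C}$ be a semi-abelian category. For objects $B,X$ of $\mathbf{C}$, a split extension of $B$ with kernel $X$ is a diagram $X\xrightarrow{k}A\xrightarrow{p}B$ together with $s\colon B\to A$ such that $p s=1_B$ and $k$ is a kernel of $p$; an isomorphism between two such, $(A,k,p,s)$ and $(A',k',p',s')$, is an isomorphism $\alpha\colon A\to A'$ with $\alpha k=k'$, $p'\alpha=p$, $\alpha s=s'$. Let $\mathrm{SplExt}(B,X)$ be the set of isomorphism classes of split extensions of $B$ with kernel $X$. For fixed $X$, pulling back $p$ (with the induced kernel and section) along morphisms $B'\to B$ makes $\mathrm{SplExt}(-,X)$ a functor $\mathbf{C}^{op}\to\mathbf{Set}$; it is naturally isomorphic to the functor $\mathrm{Act}(-,X)$ of internal object actions on $X$. $\mathbf{C}$ is action representable (has representable object actions) if for every object $X$ of $\mathbf{C}$ this functor is representable, i.e. there is an object $[X]$ of $\mathbf{C}$ and a natural isomorphism $\mathrm{SplExt}(-,X)\cong\mathrm{Hom}_{\mathbf{C}}(-,[X])$. *)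

(* Defs.v *)
From HB Require Import structures.
From mathcomp Require Import all_boot all_algebra.
From mathcomp Require Import boolp.

Set Implicit Arguments.
Unset Strict Implicit.
Unset Printing Implicit Defensive.

Import GRing.Theory.
Local Open Scope ring_scope.
Local Open Scope quotient_scope.

Declare Scope cat_scope.
Delimit Scope cat_scope with cat.

Record category := Category {
  obj :> Type;
  hom : obj -> obj -> Type;
  idm : forall A, hom A A;
  comp : forall A B C, hom B C -> hom A B -> hom A C;
  compA : forall A B C D (h : hom C D) (g : hom B C) (f : hom A B),
    comp h (comp g f) = comp (comp h g) f;
  comp1m : forall A B (f : hom A B), comp (idm B) f = f;
  compm1 : forall A B (f : hom A B), comp f (idm A) = f }.

Arguments hom {c} A B.
Arguments idm {c} A.
Notation "g \c f" := (comp g f) (at level 50, left associativity) : cat_scope.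
Local Open Scope cat_scope.

Record pointedCategory := PointedCategory {
  pcat :> category;
  zob : pcat;
  to_zob : forall A : pcat, hom A zob;
  to_zob_uniq : forall (A : pcat) (f : hom A zob), f = to_zob A;
  from_zob : forall A : pcat, hom zob A;
  from_zob_uniq : forall (A : pcat) (f : hom zob A), f = from_zob A }.

Section Pointed.
Variable C : pointedCategory.
Implicit Types A B X : C.

Definition zerom A B : hom A B := from_zob B \c to_zob A.

Definition is_kernel X A B (k : hom X A) (p : hom A B) : Prop :=
  p \c k = zerom X B /\
  forall Z (h : hom Z A), p \c h = zerom Z B -> exists! u : hom Z X, k \c u = h.

Definition is_pullback A B A' B'
    (f : hom B' B) (p : hom A B) (p' : hom A' B') (t : hom A' A) : Prop :=
  p \c t = f \c p' /\
  forall Z (a : hom Z A) (b : hom Z B'), p \c a = f \c b ->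
    exists! u : hom Z A', t \c u = a /\ p' \c u = b.

Record split_ext B X := SplitExt {
  se_mid : C;
  se_ker : hom X se_mid;
  se_proj : hom se_mid B;
  se_sec : hom B se_mid;
  se_split : se_proj \c se_sec = idm B;
  se_kerP : is_kernel se_ker se_proj }.

Definition is_iso A B (f : hom A B) : Prop :=
  exists g : hom B A, g \c f = idm A /\ f \c g = idm B.

Definition se_iso B X (E E' : split_ext B X) : Prop :=
  exists f : hom (se_mid E) (se_mid E'),
    [/\ is_iso f, f \c se_ker E = se_ker E',
        se_proj E' \c f = se_proj E & f \c se_sec E = se_sec E'].

(* [E'] is obtained from [E] by pulling back its projection along [f], with
   the induced kernel and the induced section. *)
Definition se_pullback B B' X (f : hom B' B)
    (E : split_ext B X) (E' : split_ext B' X) : Prop :=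
  exists t : hom (se_mid E') (se_mid E),
    [/\ is_pullback f (se_proj E) (se_proj E') t,
        t \c se_ker E' = se_ker E & t \c se_sec E' = se_sec E \c f].

Lemma se_iso_sym B X (E E' : split_ext B X) : se_iso E E' -> se_iso E' E.
Proof.
move=> [f [[g [gf fg]] fk pf fs]]; exists g; split.
- by exists f.
- by rewrite -fk compA gf comp1m.
- by rewrite -pf -compA fg compm1.
- by rewrite -fs compA gf comp1m.
Qed.

Lemma se_iso_trans B X (E1 E2 E3 : split_ext B X) :
  se_iso E1 E2 -> se_iso E2 E3 -> se_iso E1 E3.
Proof.
move=> [f [[g [gf fg]] fk pf fs]] [f' [[g' [gf' fg']] fk' pf' fs']].
exists (f' \c f); split.
- exists (g \c g'); split.
    by rewrite compA -[g \c g' \c f']compA gf' compm1.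
  by rewrite compA -[f' \c f \c g]compA fg compm1.
- by rewrite -compA fk.
- by rewrite compA pf'.
- by rewrite -compA fs.
Qed.

Lemma se_iso_refl B X (E : split_ext B X) : se_iso E E.
Proof.
exists (idm _); split; rewrite ?comp1m ?compm1 //.
by exists (idm _); rewrite comp1m.
Qed.

Lemma se_pullback_id B X (E E' : split_ext B X) :
  se_iso E E' -> se_pullback (idm B) E E'.
Proof.
move=> /se_iso_sym[f [[g [gf fg]] fk pf fs]]; exists f; split => //; last first.
  by rewrite compm1.
split=> [|Z a b]; first by rewrite comp1m.
rewrite comp1m => pa; exists (g \c a); split=> [|u [fu _]].
  by rewrite compA fg comp1m -pf -compA [f \c _]compA fg comp1m.
by rewrite -fu compA gf comp1m.
Qed.

Lemma se_pullback_comp B B' B'' X (f : hom B' B) (g : hom B'' B')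
    (E : split_ext B X) E' E'' :
  se_pullback f E E' -> se_pullback g E' E'' -> se_pullback (f \c g) E E''.
Proof.
move=> [t [[sq univ] tk ts]] [t' [[sq' univ'] tk' ts']].
exists (t \c t'); split.
- split=> [|Z a b pa]; first by rewrite compA sq -compA sq' compA.
  have [u [[tu pu] uniq_u]] := univ Z a (g \c b) (etrans pa (esym (compA _ _ _))).
  have [v [[tv pv] uniq_v]] := univ' Z u b pu.
  exists v; split=> [|w [tw pw]]; first by rewrite -compA tv.
  apply: uniq_v; split=> //; symmetry; apply: uniq_u.
  by rewrite compA tw compA sq' -compA pw.
- by rewrite -compA tk'.
- by rewrite -compA ts' compA ts compA.
Qed.

Lemma se_pullback_uniq B B' X (f : hom B' B) (E : split_ext B X) E1 E2 :
  se_pullback f E E1 -> se_pullback f E E2 -> se_iso E1 E2.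
Proof.
move=> [t1 [[sq1 univ1] tk1 ts1]] [t2 [[sq2 univ2] tk2 ts2]].
have [u [[t2u p2u] _]] := univ2 _ _ _ sq1.
have [v [[t1v p1v] _]] := univ1 _ _ _ sq2.
have inj1 Z (a b : hom Z (se_mid E1)) :
    t1 \c a = t1 \c b -> se_proj E1 \c a = se_proj E1 \c b -> a = b.
  move=> tab pab; have sqb : se_proj E \c (t1 \c b) = f \c (se_proj E1 \c b).
    by rewrite !compA sq1.
  have [w [_ uw]] := univ1 _ _ _ sqb.
  by rewrite -(uw a) // -(uw b).
have inj2 Z (a b : hom Z (se_mid E2)) :
    t2 \c a = t2 \c b -> se_proj E2 \c a = se_proj E2 \c b -> a = b.
  move=> tab pab; have sqb : se_proj E \c (t2 \c b) = f \c (se_proj E2 \c b).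
    by rewrite !compA sq2.
  have [w [_ uw]] := univ2 _ _ _ sqb.
  by rewrite -(uw a) // -(uw b).
exists u; split=> //.
- exists v; split.
    by apply: inj1; rewrite compA ?t1v ?p1v ?t2u ?p2u compm1.
  by apply: inj2; rewrite compA ?t2u ?p2u ?t1v ?p1v compm1.
- apply: inj2; first by rewrite compA t2u tk1 tk2.
  by rewrite compA p2u (se_kerP E1).1 (se_kerP E2).1.
- apply: inj2; first by rewrite compA t2u ts1 ts2.
  by rewrite compA p2u !se_split.
Qed.

Lemma se_pullback_iso B B' X (f : hom B' B) (E1 E2 : split_ext B X) E1' E2' :
  se_iso E1 E2 -> se_iso E1' E2' -> se_pullback f E1 E1' -> se_pullback f E2 E2'.
Proof.
move=> /se_iso_sym/se_pullback_id i12 /se_pullback_id i12' pf.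
have := se_pullback_comp (se_pullback_comp i12 pf) i12'.
by rewrite comp1m compm1.
Qed.

(* The set of isomorphism classes, as subsets of [split_ext B X]; a quotient
   type with choice structure would force a universe level on [C]. *)
Record SplExt B X := SplExtClass {
  se_mem :> split_ext B X -> Prop;
  se_memP : exists E, se_mem = se_iso E }.

Lemma SplExt_eq B X (c d : SplExt B X) : (forall E, c E <-> d E) -> c = d.
Proof.
case: c d => [c cP] [d dP] /= cd.
have e : c = d by apply: funext => E; apply: propext.
by case: d / e dP {cd} => dP; congr SplExtClass; apply: Prop_irrelevance.
Qed.

Lemma SplExt_iso B X (c : SplExt B X) E E' : c E -> c E' <-> se_iso E E'.
Proof.
case: c => c [E0 e] /=; rewrite {c}e => iE; split=> [iE'|]; last exact: se_iso_trans.
exact: se_iso_trans (se_iso_sym iE) iE'.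
Qed.

Lemma SplExt_ex B X (c : SplExt B X) : exists E, c E.
Proof. by case: c => c [E e] /=; exists E; rewrite e; apply: se_iso_refl. Qed.

Definition splext_class B X (E : split_ext B X) : SplExt B X :=
  SplExtClass (ex_intro _ E (erefl (se_iso E))).

Definition has_se_pullbacks : Prop :=
  forall B B' X (f : hom B' B) (E : split_ext B X),
    exists E' : split_ext B' X, se_pullback f E E'.

Section Pull.
Hypothesis pb : has_se_pullbacks.

Lemma SplExt_pull_subproof B B' X (f : hom B' B) (c : SplExt B X) :
  exists E', (fun F => exists2 E, c E & se_pullback f E F) = se_iso E'.
Proof.
have [E cE] := SplExt_ex c; have [E' EE'] := pb f E.
exists E'; apply: funext => F; apply: propext; split=> [[G cG GF]|iF].
  move/(SplExt_iso _ cE): cG => iEG.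
  exact: se_pullback_uniq (se_pullback_iso iEG (se_iso_refl _) EE') GF.
by exists E => //; apply: se_pullback_iso (se_iso_refl _) iF EE'.
Qed.

Definition SplExt_pull B B' X (f : hom B' B) (c : SplExt B X) : SplExt B' X :=
  SplExtClass (SplExt_pull_subproof f c).

Lemma SplExt_pull_id B X (c : SplExt B X) : SplExt_pull (idm B) c = c.
Proof.
have [E cE] := SplExt_ex c.
apply: SplExt_eq => F; split=> [[G cG GF]|cF] /=.
  have iGF := se_pullback_uniq (se_pullback_id (se_iso_refl G)) GF.
  exact/(SplExt_iso _ cG).
by exists F => //; apply: se_pullback_id (se_iso_refl F).
Qed.

Lemma SplExt_pull_comp B B' B'' X (f : hom B' B) (g : hom B'' B')
    (c : SplExt B X) :
  SplExt_pull (f \c g) c = SplExt_pull g (SplExt_pull f c).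
Proof.
apply: SplExt_eq => F; split=> [[E cE EF]|[G [E cE EG] GF]] /=; last first.
  by exists E => //; apply: se_pullback_comp EG GF.
have [G EG] := pb f E; have [H GH] := pb g G.
exists G; first by exists E.
have iHF := se_pullback_uniq (se_pullback_comp EG GH) EF.
exact: se_pullback_iso (se_iso_refl _) iHF GH.
Qed.

End Pull.

End Pointed.

Record presheaf (C : category) := Presheaf {
  psh_obj :> C -> Type;
  psh_map : forall B B' : C, hom B' B -> psh_obj B -> psh_obj B';
  psh_id : forall (B : C) (x : psh_obj B), psh_map (idm B) x = x;
  psh_comp : forall (B B' B'' : C) (f : hom B' B) (g : hom B'' B')
    (x : psh_obj B), psh_map (f \c g) x = psh_map g (psh_map f x) }.

Definition representable (C : category) (F : presheaf C) : Prop :=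
  exists (R : C) (phi : forall B : C, F B -> hom B R),
    (forall B, bijective (phi B)) /\
    (forall (B B' : C) (f : hom B' B) (x : F B),
       phi B' (psh_map f x) = phi B x \c f).

Definition SplExt_presheaf (C : pointedCategory) (pb : has_se_pullbacks C)
    (X : C) : presheaf C :=
  @Presheaf C (fun B => SplExt B X)
    (fun B B' f c => SplExt_pull pb f c)
    (fun B x => SplExt_pull_id pb x)
    (fun B B' B'' f g x => SplExt_pull_comp pb f g x).

(* The existence of pullbacks of split extensions is what makes SplExt(-, X)
   a functor; being a proposition, the choice of [pb] is immaterial. *)
Definition action_representable (C : pointedCategory) : Prop :=
  exists pb : has_se_pullbacks C,
    forall X : C, representable (SplExt_presheaf pb X).

Section Tensor.
Variable K : fieldType.
Implicit Types U V W : lmodType K.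

(* A finite sum of pure tensors is a list of pairs; [teq] is the congruence on
   the free commutative monoid on [V * W] generated by bilinearity. *)
Inductive teq V W : seq (V * W) -> seq (V * W) -> Prop :=
| teq_sym s t : teq s t -> teq t s
| teq_trans s t u : teq s t -> teq t u -> teq s u
| teq_perm s t : perm_eq s t -> teq s t
| teq_cons p s t : teq s t -> teq (p :: s) (p :: t)
| teq_Dl v v' w s : teq ((v + v', w) :: s) [:: (v, w), (v', w) & s]
| teq_Dr v w w' s : teq ((v, w + w') :: s) [:: (v, w), (v, w') & s]
| teq_Z a v w s : teq ((a *: v, w) :: s) ((v, a *: w) :: s)
| teq_0 w s : teq ((0, w) :: s) s.

Lemma teq_refl V W (s : seq (V * W)) : teq s s.
Proof. exact: teq_perm. Qed.

Lemma teq_catl V W (u s t : seq (V * W)) : teq s t -> teq (u ++ s) (u ++ t).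
Proof. by move=> st; elim: u => //= p u; apply: teq_cons. Qed.

Lemma teq_cat V W (s s' t t' : seq (V * W)) :
  teq s s' -> teq t t' -> teq (s ++ t) (s' ++ t').
Proof.
move=> ss' tt'; apply: (teq_trans (teq_catl s tt')).
apply: (@teq_trans _ _ _ (t' ++ s)); first by apply: teq_perm; rewrite perm_catC.
apply: (@teq_trans _ _ _ (t' ++ s')); first exact: teq_catl.
by apply: teq_perm; rewrite perm_catC.
Qed.

Lemma teq_scale V W a (s t : seq (V * W)) :
  teq s t -> teq [seq (a *: p.1, p.2) | p <- s] [seq (a *: p.1, p.2) | p <- t].
Proof.
elim=> {s t} [s t _|s t u _ + _|s t|p s t _|v v' w s|v w w' s|b v w s|w s] /=.
- exact: teq_sym.
- exact: teq_trans.
- by move=> /(perm_map (fun p : V * W => (a *: p.1, p.2))); apply: teq_perm.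
- exact: teq_cons.
- by rewrite scalerDr; apply: teq_Dl.
- exact: teq_Dr.
- by rewrite scalerA mulrC -scalerA; apply: teq_Z.
- by rewrite scaler0; apply: teq_0.
Qed.

Definition teqb V W (s t : seq (V * W)) : bool := `[< teq s t >].

Lemma teqb_refl V W : reflexive (@teqb V W).
Proof. by move=> s; apply/asboolP/teq_refl. Qed.
Lemma teqb_sym V W : symmetric (@teqb V W).
Proof. by move=> s t; apply/asboolP/asboolP; apply: teq_sym. Qed.
Lemma teqb_trans V W : transitive (@teqb V W).
Proof.
by move=> t s u /asboolP st /asboolP tu; apply/asboolP; apply: teq_trans st tu.
Qed.

Canonical teq_equiv V W :=
  EquivRel (@teqb V W) (@teqb_refl V W) (@teqb_sym V W) (@teqb_trans V W).

Definition tensor V W : Type := {eq_quot (@teq_equiv V W)}.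
HB.instance Definition _ V W := Choice.on (tensor V W).

Definition tclass V W (s : seq (V * W)) : tensor V W :=
  \pi_({eq_quot (@teq_equiv V W)}) s.
Definition trepr V W (t : tensor V W) : seq (V * W) :=
  repr (t : {eq_quot (@teq_equiv V W)}).

Lemma treprK V W : cancel (@trepr V W) (@tclass V W).
Proof. exact: reprK. Qed.

Lemma tclassP V W (s t : seq (V * W)) : tclass s = tclass t <-> teq s t.
Proof.
split=> [/eqP|st]; first by rewrite (eqmodE (@teq_equiv V W)) => /asboolP.
by apply/eqP; rewrite (eqmodE (@teq_equiv V W)); apply/asboolP.
Qed.

Lemma teq_repr V W (s : seq (V * W)) : teq (trepr (tclass s)) s.
Proof. by apply/tclassP; rewrite treprK. Qed.

Definition tadd V W (x y : tensor V W) := tclass (trepr x ++ trepr y).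
Definition tscale V W (a : K) (x : tensor V W) :=
  tclass [seq (a *: p.1, p.2) | p <- trepr x].
Definition topp V W (x : tensor V W) := tscale (-1) x.
Definition tzero V W : tensor V W := tclass [::].

Lemma taddE V W (s t : seq (V * W)) :
  tadd (tclass s) (tclass t) = tclass (s ++ t).
Proof. by apply/tclassP/teq_cat; apply: teq_repr. Qed.

Lemma tscaleE V W a (s : seq (V * W)) :
  tscale a (tclass s) = tclass [seq (a *: p.1, p.2) | p <- s].
Proof. exact/tclassP/teq_scale/teq_repr. Qed.

Lemma taddA V W : associative (@tadd V W).
Proof.
move=> x y z; rewrite -[x]treprK -[y]treprK -[z]treprK !taddE.
by rewrite catA.
Qed.

Lemma taddC V W : commutative (@tadd V W).
Proof. by move=> x y; apply/tclassP/teq_perm; rewrite perm_catC. Qed.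

Lemma tadd0 V W : left_id (@tzero V W) (@tadd V W).
Proof. by move=> x; rewrite -[x]treprK taddE. Qed.

Lemma taddN V W : left_inverse (@tzero V W) (@topp V W) (@tadd V W).
Proof.
move=> x; rewrite -[x]treprK; elim: (trepr x) => [|[v w] s IHs].
  by rewrite /topp tscaleE taddE.
rewrite -[RHS]IHs /topp !tscaleE !taddE /=; apply/tclassP.
set s' := map _ _.
apply: (@teq_trans _ _ _ [:: (- v, w), (v, w) & s' ++ s]).
  apply: teq_perm; rewrite scaleN1r perm_cons.
  by rewrite -cat1s perm_catCA.
apply: teq_trans (teq_sym (teq_Dl _ _ _ _)) _.
by rewrite addNr; apply: teq_0.
Qed.

HB.instance Definition _ V W := GRing.isZmodule.Build (tensor V W)
  (@taddA V W) (@taddC V W) (@tadd0 V W) (@taddN V W).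

Lemma tscaleA V W a b (x : tensor V W) : tscale a (tscale b x) = tscale (a * b) x.
Proof.
rewrite -[x]treprK !tscaleE -map_comp; congr tclass.
by apply: eq_map => p /=; rewrite scalerA.
Qed.

Lemma tscale1 V W : left_id 1 (@tscale V W).
Proof.
move=> x; rewrite -[x]treprK tscaleE; congr tclass.
by rewrite -[RHS]map_id; apply: eq_map => -[v w] /=; rewrite scale1r.
Qed.

Lemma tscaleDr V W : right_distributive (@tscale V W) +%R.
Proof.
move=> a x y; rewrite -[x]treprK -[y]treprK.
by rewrite [_ + _ in LHS]taddE !tscaleE [RHS]taddE map_cat.
Qed.

Lemma tscaleDl V W (x : tensor V W) : {morph (@tscale V W)^~ x : a b / a + b}.
Proof.
move=> a b; rewrite -[x]treprK !tscaleE [RHS]taddE; apply/tclassP.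
elim: (trepr x) => [|[v w] s IHs] /=; first exact: teq_refl.
rewrite scalerDl; apply: teq_trans (teq_Dl _ _ _ _) _.
apply: teq_cons; apply: teq_trans (teq_cons _ IHs) _.
by apply: teq_perm; rewrite perm_sym -cat1s perm_catCA.
Qed.

HB.instance Definition _ V W := GRing.Zmodule_isLmodule.Build K (tensor V W)
  (@tscaleA V W) (@tscale1 V W) (@tscaleDr V W) (@tscaleDl V W).

Definition tens V W (v : V) (w : W) : tensor V W := tclass [:: (v, w)].
Local Notation "v *t w" := (tens v w) (at level 40, left associativity).

Definition bilin U V W (f : U -> V -> W) : Prop :=
  (forall v, linear (f^~ v)) /\ (forall u, linear (f u)).

Lemma tensZl V W a (v : V) (w : W) : (a *: v) *t w = a *: (v *t w).
Proof. by rewrite [RHS]tscaleE. Qed.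

Lemma tens_bilin V W : bilin (@tens V W).
Proof.
split=> [w a v v'|v a w w'].
  rewrite -tensZl [RHS]taddE; exact/tclassP/teq_Dl.
rewrite -tensZl [RHS]taddE; apply/tclassP/(teq_trans (teq_Dr _ _ _ _)).
exact/teq_sym/teq_Z.
Qed.

Lemma tensE V W (x : tensor V W) : x = \sum_(p <- trepr x) p.1 *t p.2.
Proof.
rewrite -[LHS]treprK; elim: (trepr x) => [|[v w] s IHs]; first by rewrite big_nil.
by rewrite big_cons -IHs [RHS]taddE.
Qed.

(* For [f] bilinear, the linear map with [v *t w |-> f v w]; see [tliftE],
   [tlift_linear] and [tlift_uniq]. *)
Definition tlift V W U (f : V -> W -> U) (x : tensor V W) : U :=
  \sum_(p <- trepr x) f p.1 p.2.

Lemma teq_sum V W U (f : V -> W -> U) (s t : seq (V * W)) : bilin f ->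
  teq s t -> \sum_(p <- s) f p.1 p.2 = \sum_(p <- t) f p.1 p.2.
Proof.
move=> [fl fr].
have fDl w v v' : f (v + v') w = f v w + f v' w.
  by have := fl w 1 v v'; rewrite !scale1r.
have fDr v w w' : f v (w + w') = f v w + f v w'.
  by have := fr v 1 w w'; rewrite !scale1r.
have f0l w : f 0 w = 0 by apply: (addrI (f 0 w)); rewrite -fDl !addr0.
have f0r v : f v 0 = 0 by apply: (addrI (f v 0)); rewrite -fDr !addr0.
have fZ a v w : f (a *: v) w = f v (a *: w).
  have := fl w a v 0; have := fr v a w 0.
  by rewrite !addr0 f0l f0r !addr0 => -> ->.
elim=> {s t} [s t _ -> //|s t u _ -> //|s t|p s t _|v v' w s|v w w' s|b v w s|w s].
- exact: perm_big.
- by rewrite !big_cons => ->.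
- by rewrite !big_cons /= fDl addrA.
- by rewrite !big_cons /= fDr addrA.
- by rewrite !big_cons /= fZ.
- by rewrite !big_cons /= f0l add0r.
Qed.

Lemma tlift_class V W U (f : V -> W -> U) (s : seq (V * W)) : bilin f ->
  tlift f (tclass s) = \sum_(p <- s) f p.1 p.2.
Proof. by move=> fb; apply: teq_sum (teq_repr s). Qed.

Lemma tliftE V W U (f : V -> W -> U) (v : V) (w : W) : bilin f ->
  tlift f (v *t w) = f v w.
Proof. by move=> fb; rewrite tlift_class // big_seq1. Qed.

Lemma tlift_linear V W U (f : V -> W -> U) : bilin f -> linear (tlift f).
Proof.
move=> fb a x y; rewrite -[x]treprK -[y]treprK.
rewrite [_ *: _ in LHS]tscaleE [X in tlift f X]taddE !tlift_class //.
rewrite big_cat big_map; congr (_ + _); rewrite scaler_sumr.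
apply: eq_bigr => -[v w] _ /=.
have f0 : f 0 w = 0.
  by apply: (addrI (f 0 w)); have := fb.1 w 1 0 0; rewrite !scale1r !addr0 => <-.
by have := fb.1 w a v 0; rewrite !addr0 f0 addr0.
Qed.

Lemma tlift_uniq V W U (g h : {linear tensor V W -> U}) :
  (forall v w, g (v *t w) = h (v *t w)) -> g =1 h.
Proof. by move=> gh x; rewrite [x]tensE !linear_sum; apply: eq_bigr => p _. Qed.

Definition tmap V W V' W' (f : V -> V') (g : W -> W') :
    tensor V W -> tensor V' W' :=
  tlift (fun v w => f v *t g w).

Definition tswap V W : tensor V W -> tensor W V := tlift (fun v w => w *t v).

Definition tassoc U V W : tensor (tensor U V) W -> tensor U (tensor V W) :=
  tlift (fun x w => tlift (fun u v => u *t (v *t w)) x).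

Definition tmul (A B : algType K) (x y : tensor A B) : tensor A B :=
  tlift (fun a b => tlift (fun a' b' => (a * a') *t (b * b')) y) x.

Lemma tmapE V W V' W' (f : {linear V -> V'}) (g : {linear W -> W'}) v w :
  tmap f g (v *t w) = f v *t g w.
Proof.
apply: (tliftE v w (f := fun v w => f v *t g w)); split.
  by move=> z a x y /=; rewrite linearP (tens_bilin _ _).1.
by move=> z a x y /=; rewrite linearP (tens_bilin _ _).2.
Qed.

Lemma tswapE V W (v : V) (w : W) : tswap (v *t w) = w *t v.
Proof.
by apply: (tliftE v w (f := fun v w => w *t v)); split=> z a x y;
  [apply: (tens_bilin _ _).2 | apply: (tens_bilin _ _).1].
Qed.

Lemma tlift_param V W U (Z : lmodType K) (f : Z -> V -> W -> U) (x : tensor V W) :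
  (forall v w, linear (fun z => f z v w)) -> linear (fun z => tlift (f z) x).
Proof.
move=> fl a y z; rewrite /tlift scaler_sumr -big_split.
by apply: eq_bigr => p _ /=; apply: fl.
Qed.

Lemma tassocE U V W (u : U) (v : V) (w : W) :
  tassoc (u *t v *t w) = u *t (v *t w).
Proof.
have b w' : bilin (fun (u : U) (v : V) => u *t (v *t w')).
  split=> z a x y; first exact: (tens_bilin _ _).1.
  by rewrite (tens_bilin _ _).1 (tens_bilin _ _).2.
rewrite /tassoc (tliftE (f := fun x w => tlift (fun u v => u *t (v *t w)) x)).
  by rewrite tliftE.
split=> [w'|x]; first exact: tlift_linear.
apply: tlift_param => u' v' a y z.
by rewrite (tens_bilin _ _).2 (tens_bilin _ _).2.
Qed.

Lemma tmulE (A B : algType K) (a a' : A) (b b' : B) :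
  tmul (a *t b) (a' *t b') = (a * a') *t (b * b').
Proof.
have bl c d : bilin (fun (a' : A) (b' : B) => (c * a') *t (d * b')).
  split=> z e x y; first by rewrite mulrDr -scalerAr (tens_bilin _ _).1.
  by rewrite mulrDr -scalerAr (tens_bilin _ _).2.
rewrite /tmul
  (tliftE (f := fun a b => tlift (fun a' b' => (a * a') *t (b * b')) _)).
  by rewrite tliftE.
split=> z; apply: tlift_param => v w e x y.
  by rewrite mulrDl -scalerAl (tens_bilin _ _).1.
by rewrite mulrDl -scalerAl (tens_bilin _ _).2.
Qed.

End Tensor.

Notation "v *t w" := (tens v w) (at level 40, left associativity) : ring_scope.
Arguments tassoc {K U V W} _.
Arguments tswap {K V W} _.

Record cocHopf (K : fieldType) := CocHopf {
  hopf_alg :> algType K;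
  comul : {linear hopf_alg -> tensor hopf_alg hopf_alg};
  counit : {lrmorphism hopf_alg -> K^o};
  antipode : {linear hopf_alg -> hopf_alg};
  comul1 : comul 1 = 1 *t 1;
  comulM : forall x y, comul (x * y) = tmul (comul x) (comul y);
  comulA : forall x,
    tassoc (tmap comul idfun (comul x)) = tmap idfun comul (comul x);
  counitl : forall x, tlift (fun a b => counit a *: b) (comul x) = x;
  counitr : forall x, tlift (fun a b => counit b *: a) (comul x) = x;
  antipodel : forall x, tlift (fun a b => antipode a * b) (comul x) = (counit x)%:A;
  antipoder : forall x, tlift (fun a b => a * antipode b) (comul x) = (counit x)%:A;
  comulC : forall x, tswap (comul x) = comul x }.

Arguments comul {K} c : rename.
Arguments counit {K} c : rename.
Arguments antipode {K} c : rename.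

Section HopfCat.
Variable K : fieldType.
Implicit Types A B C D : cocHopf K.

Record bialgHom A B := BialgHom {
  bialg_fun :> {lrmorphism A -> B};
  bialg_comul : forall x, comul B (bialg_fun x) = tmap bialg_fun bialg_fun (comul A x);
  bialg_counit : forall x, counit B (bialg_fun x) = counit A x }.

Lemma bialgHom_eq A B (f g : bialgHom A B) : f =1 g -> f = g.
Proof.
case: f g => [f f1 f2] [g g1 g2] /= fg.
have e : f = g.
  case: f fg {f1 f2} => f cf; case: g {g1 g2} => g cg /= fg.
  have e : f = g by apply: funext.
  case: g / e cg {fg} => cg; congr GRing.LRMorphism.Pack.
  case: cf => [[p1] [p2] [p3]]; case: cg => [[q1] [q2] [q3]].
  by congr GRing.LRMorphism.Class; congr (_ _); apply: Prop_irrelevance.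
case: g / e g1 g2 {fg} => g1 g2.
by congr BialgHom; apply: Prop_irrelevance.
Qed.

Lemma tmap_comp (U V W U' V' W' : lmodType K)
    (f : {linear V -> W}) (g : {linear U -> V})
    (f' : {linear V' -> W'}) (g' : {linear U' -> V'}) x :
  tmap f f' (tmap g g' x) = tmap (f \o g) (f' \o g') x.
Proof.
have b : bilin (fun v w => f v *t f' w).
  by split=> z a y y'; rewrite linearP;
    [apply: (tens_bilin _ _).1 | apply: (tens_bilin _ _).2].
rewrite [in LHS](_ : tmap g g' x = \sum_(p <- trepr x) g p.1 *t g' p.2) //.
set F : {linear _ -> _} :=
  HB.pack (tmap f f') (GRing.isLinear.Build _ _ _ _ _ (tlift_linear b)).
rewrite -[tmap f f' _]/(F _) linear_sum; apply: eq_bigr => p _ /=.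
exact: tmapE.
Qed.

Lemma tmap_id (V W : lmodType K) (x : tensor V W) : tmap idfun idfun x = x.
Proof. by rewrite [RHS]tensE. Qed.

Lemma bialg_id_comul A x : comul A (idfun x) = tmap idfun idfun (comul A x).
Proof. by rewrite tmap_id. Qed.

Definition bialg_id A : bialgHom A A :=
  @BialgHom A A idfun (@bialg_id_comul A) (fun=> erefl).

Lemma bialg_comp_comul A B C (g : bialgHom B C) (f : bialgHom A B) x :
  comul C ((g \o f) x) = tmap (g \o f) (g \o f) (comul A x).
Proof. by rewrite /= !bialg_comul tmap_comp. Qed.

Lemma bialg_comp_counit A B C (g : bialgHom B C) (f : bialgHom A B) x :
  counit C ((g \o f) x) = counit A x.
Proof. by rewrite /= !bialg_counit. Qed.

Definition bialg_comp A B C (g : bialgHom B C) (f : bialgHom A B) : bialgHom A C :=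
  @BialgHom A C (g \o f) (bialg_comp_comul g f) (bialg_comp_counit g f).

Lemma bialg_compA A B C D (h : bialgHom C D) (g : bialgHom B C)
    (f : bialgHom A B) :
  bialg_comp h (bialg_comp g f) = bialg_comp (bialg_comp h g) f.
Proof. exact: bialgHom_eq. Qed.

Lemma bialg_comp1m A B (f : bialgHom A B) : bialg_comp (bialg_id B) f = f.
Proof. exact: bialgHom_eq. Qed.

Lemma bialg_compm1 A B (f : bialgHom A B) : bialg_comp f (bialg_id A) = f.
Proof. exact: bialgHom_eq. Qed.

Definition Hopf_coc_cat : category :=
  @Category (cocHopf K) bialgHom bialg_id bialg_comp
    bialg_compA bialg_comp1m bialg_compm1.

Definition unit_comul (a : K^o) : tensor K^o K^o := a *t 1.

Lemma unit_comul_linear : linear unit_comul.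
Proof. by move=> a x y; apply: (tens_bilin _ _).1. Qed.

HB.instance Definition _ :=
  GRing.isLinear.Build K K^o (tensor K^o K^o) *:%R unit_comul unit_comul_linear.

Lemma tensZ (x y : K^o) (V : lmodType K) (v : V) : (x * y : K^o) *t v = x *t (y *: v).
Proof. by rewrite mulrC; apply/tclassP; apply: (@teq_Z K K^o V y x v). Qed.

Lemma unit_bilin : bilin (fun a b : K^o => a * b : K^o).
Proof.
split=> z a x y; first by rewrite mulrDl -scalerAl.
by rewrite mulrDr -scalerAr.
Qed.

Lemma unit_bilinC : bilin (fun a b : K^o => b * a : K^o).
Proof. by split; [exact: unit_bilin.2 | exact: unit_bilin.1]. Qed.

Lemma unit_comulM x y : unit_comul (x * y) = tmul (unit_comul x) (unit_comul y).
Proof. by rewrite tmulE mulr1. Qed.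

Lemma unit_comulA x : tassoc (tmap unit_comul idfun (unit_comul x)) =
  tmap idfun unit_comul (unit_comul x).
Proof. by rewrite !tmapE tassocE. Qed.

Lemma unit_mull x : tlift (fun a b : K^o => a * b : K^o) (unit_comul x) = x.
Proof. by rewrite (tliftE _ _ unit_bilin) mulr1. Qed.

Lemma unit_mulr x : tlift (fun a b : K^o => b * a : K^o) (unit_comul x) = x.
Proof. by rewrite (tliftE _ _ unit_bilinC) mul1r. Qed.

Lemma unit_antipode x :
  tlift (fun a b : K^o => a * b : K^o) (unit_comul x) = (x : K)%:A.
Proof. by rewrite unit_mull [RHS]mulr1. Qed.

Lemma unit_comulC x : tswap (unit_comul x) = unit_comul x.
Proof. by rewrite tswapE -[X in _ = X *t _]mul1r tensZ [_ *: _]mulr1. Qed.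

Definition unit_hopf : cocHopf K :=
  @CocHopf K K^o unit_comul idfun idfun erefl unit_comulM unit_comulA
    unit_mull unit_mulr unit_antipode unit_antipode unit_comulC.

Lemma counit_comul A x : comul unit_hopf (counit A x) =
  tmap (counit A) (counit A) (comul A x).
Proof.
rewrite -[in LHS](counitl x) /tmap /tlift !linear_sum.
apply: eq_bigr => p _; rewrite linearZ /= /unit_comul.
by rewrite (tensZ _ _ (1 : K^o)) [_ *: _]mulr1.
Qed.

Definition to_unit A : bialgHom A unit_hopf :=
  @BialgHom A unit_hopf (counit A) (@counit_comul A) (fun=> erefl).

Lemma to_unit_uniq A (f : bialgHom A unit_hopf) : f = to_unit A.
Proof. by apply: bialgHom_eq => x; rewrite -(bialg_counit f). Qed.

Definition of_unit_fun A (x : K^o) : A := x%:A.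

Lemma of_unit_linear A : linear (of_unit_fun A).
Proof. by move=> a x y; rewrite /of_unit_fun scalerDl scalerA. Qed.

Lemma of_unit_monoid A : monoid_morphism (of_unit_fun A).
Proof.
by split=> [|x y]; rewrite /of_unit_fun ?scale1r // -scalerAl mul1r scalerA.
Qed.

HB.instance Definition _ A := GRing.isLinear.Build K K^o A *:%R
  (of_unit_fun A) (@of_unit_linear A).
HB.instance Definition _ A := GRing.isMonoidMorphism.Build K^o A
  (of_unit_fun A) (@of_unit_monoid A).

Lemma of_unit_comul A (x : unit_hopf) : comul A (of_unit_fun A x) =
  tmap (of_unit_fun A) (of_unit_fun A) (comul unit_hopf x).
Proof.
rewrite [comul unit_hopf x]/(unit_comul x) tmapE /= /of_unit_fun.
by rewrite scale1r linearZ /= comul1 tensZl.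
Qed.

Lemma of_unit_counit A (x : unit_hopf) : counit A (of_unit_fun A x) = counit unit_hopf x.
Proof. by rewrite /= /of_unit_fun linearZ /= rmorph1 [LHS]mulr1. Qed.

Definition of_unit A : bialgHom unit_hopf A :=
  @BialgHom unit_hopf A (of_unit_fun A) (@of_unit_comul A) (@of_unit_counit A).

Lemma of_unit_uniq A (f : bialgHom unit_hopf A) : f = of_unit A.
Proof.
apply: bialgHom_eq => x.
have e : bialg_fun f ((x : K) *: 1) = (x : K) *: bialg_fun f 1 by exact: linearZ.
by rewrite /= /of_unit_fun -[1 in RHS](rmorph1 (bialg_fun f)) -e [_ *: _]mulr1.
Qed.

Definition Hopf_coc : pointedCategory :=
  @PointedCategory Hopf_coc_cat unit_hopf to_unit to_unit_uniq of_unit of_unit_uniq.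

End HopfCat.

(* Main.v *)
Require Import Defs.
From HB Require Import structures.
From mathcomp Require Import all_boot all_algebra.
From mathcomp Require Import boolp classical_sets functions.

(** A cocommutative Hopf algebra is a group object in the category of
cocommutative coalgebras, which is cartesian, the product being the tensor
product; so identities can be checked in the groups of T-points Coalg(T, A).
A split extension of B with kernel X is a semidirect product, hence amounts to
an action of B on X by automorphisms. The category of cocommutative coalgebras
is cartesian closed, so that there is an internal automorphism group Aut(X) of X,
and actions of B on X are the morphisms B -> Aut(X). As a coalgebra, Aut(X) is
terminal among the coalgebras C with a pair of linear maps C -> End(X)
describing mutually inverse automorphisms of X parametrised by C; it is realised
in the space of functions on words of linear functionals, by sending c to
l1 .. ln |-> sum l1(f c1) .. ln(f cn), with Sweedler's notation for the iterated
coproduct of c. *)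

Set Implicit Arguments.
Unset Strict Implicit.
Unset Printing Implicit Defensive.

Import GRing.Theory.
Local Open Scope ring_scope.

(** * Tensor products *)

Section TensorTools.
Variable K : fieldType.
Implicit Types U V W : lmodType K.

(** Two obstacles shape the construction. The candidate coproduct of a function F on words is (w,
    w') |-> F (w ++ w'), which in general is no finite sum of products F1(w) F2(w'). It is one for
    the functions that come from coalgebras, hence on their span. That span ranges over all
    coalgebras at once without any question of size, being cut out by a proposition inside one fixed
    space. Inverses are carried along as a second map because mutual inverseness is then an
    equation, and equations pass from generators to the span; bare invertibility is an existence
    statement and need not. The other obstacle is that kernels are tested by Hopf algebras only,
    whereas points are taken over arbitrary coalgebras. So the retract of A cut out by a |-> a s(p
    a)^-1 is itself made into a Hopf algebra before the kernel property is applied to it. General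
    pullbacks are not constructed: the pullback of a split extension along f is the semidirect
    product for the classifying map composed with f. *)

Lemma tensDl V W (v v' : V) (w : W) : (v + v') *t w = v *t w + v' *t w.
Proof. by have := (tens_bilin V W).1 w 1 v v'; rewrite !scale1r. Qed.

Lemma tensDr V W (v : V) (w w' : W) : v *t (w + w') = v *t w + v *t w'.
Proof. by have := (tens_bilin V W).2 v 1 w w'; rewrite !scale1r. Qed.

Lemma tens0l V W (w : W) : (0 : V) *t w = 0.
Proof. by apply: (addrI ((0 : V) *t w)); rewrite -tensDl !addr0. Qed.

Lemma tens0r V W (v : V) : v *t (0 : W) = 0.
Proof. by apply: (addrI (v *t (0 : W))); rewrite -tensDr !addr0. Qed.

Lemma tensZr V W a (v : V) (w : W) : v *t (a *: w) = a *: (v *t w).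
Proof. by have := (tens_bilin V W).2 v a w 0; rewrite tens0r !addr0. Qed.

(** The zero tensor is covered by the first case, as [0 *t 0]. *)
Lemma tens_ind V W (P : tensor V W -> Prop) :
  (forall v w, P (v *t w)) -> (forall x y, P x -> P y -> P (x + y)) ->
  forall x, P x.
Proof.
move=> P1 PD x; rewrite [x]tensE; apply: (big_ind P) => //.
by rewrite -(tens0l V (0 : W)).
Qed.

Lemma linear_tmap V W V' W' (f : {linear V -> V'}) (g : {linear W -> W'}) :
  linear (tmap f g).
Proof.
apply: tlift_linear; split=> z a x y; rewrite linearP.
  by rewrite tensDl tensZl.
by rewrite tensDr tensZr.
Qed.

HB.instance Definition _ V W V' W' (f : {linear V -> V'}) (g : {linear W -> W'}) :=
  GRing.isLinear.Build K (tensor V W) (tensor V' W') *:%R (tmap f g)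
    (linear_tmap f g).

Lemma linear_tswap V W : linear (@tswap K V W).
Proof.
by apply: tlift_linear; split=> z a x y; rewrite ?tensDr ?tensZr ?tensDl ?tensZl.
Qed.

HB.instance Definition _ V W :=
  GRing.isLinear.Build K (tensor V W) (tensor W V) *:%R (@tswap K V W)
    (@linear_tswap V W).

(** The proof of bilinearity is an argument, so that linearity of the lift can be inferred from the
    term itself. *)
Definition tlin V W U (f : V -> W -> U) of bilin f := tlift f.

HB.instance Definition _ V W U (f : V -> W -> U) (bf : bilin f) :=
  GRing.isLinear.Build K (tensor V W) U *:%R (tlin bf) (tlift_linear bf).

Lemma bilin_assoc U V W : bilin
  (fun (x : tensor U V) (w : W) => tlift (fun u v => u *t (v *t w)) x).
Proof.
split=> [w'|x].
  by apply: tlift_linear; split=> z a x y; rewrite ?tensDl ?tensZl ?tensDr ?tensZr.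
by apply: tlift_param => u' v' a y z; rewrite !(tensDr, tensZr).
Qed.

HB.instance Definition _ U V W :=
  GRing.isLinear.Build K (tensor (tensor U V) W) (tensor U (tensor V W)) *:%R
    (@tassoc K U V W) (tlift_linear (@bilin_assoc U V W)).

Lemma eq_tmap V W V' W' (f f' : V -> V') (g g' : W -> W') :
  f =1 f' -> g =1 g' -> tmap f g =1 tmap f' g'.
Proof. by move=> /funext-> /funext->. Qed.

Lemma bilin_mid (U V U' V' : lmodType K) : bilin
  (fun (x : tensor U V) (y : tensor U' V') =>
    tlift (fun u v => tlift (fun u' v' => (u *t u') *t (v *t v')) y) x).
Proof.
have bl (c : U) (d : V) :
    bilin (fun (a' : U') (b' : V') => (c *t a') *t (d *t b')).
  by split=> z e x y; rewrite !(tensDr, tensZr, tensDl, tensZl).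
split=> z.
  apply: tlift_linear; split=> t; apply: tlift_param => v w e x y.
    by rewrite !(tensDr, tensZr, tensDl, tensZl).
  by rewrite !(tensDr, tensZr, tensDl, tensZl).
by apply: tlift_param => v w; apply: tlift_linear.
Qed.

Definition mid U V U' V' :
    tensor (tensor U V) (tensor U' V') -> tensor (tensor U U') (tensor V V') :=
  tlin (@bilin_mid U V U' V').
HB.instance Definition _ U V U' V' := GRing.Linear.on (@mid U V U' V').

Lemma midE U V U' V' (u : U) (v : V) (u' : U') (v' : V') :
  mid ((u *t v) *t (u' *t v')) = (u *t u') *t (v *t v').
Proof.
rewrite /mid /tlin tliftE; last exact: bilin_mid.
rewrite tliftE; first rewrite tliftE //.
  by split=> z e x y; rewrite !(tensDr, tensZr, tensDl, tensZl).
by split=> t; apply: tlift_param => v0 w e x y;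
  rewrite !(tensDr, tensZr, tensDl, tensZl).
Qed.

End TensorTools.

(** * Cocommutative coalgebras *)

(** Does the work of Sweedler's notation: in an identity linear in [x], usually a generalised
    coproduct, [x] is reduced to a pure tensor [u *t v], and the case of a sum is closed by
    additivity. *)
Ltac tensor_elim x u v :=
  let y := fresh "y" in let z := fresh "z" in
  let IHy := fresh "IHy" in let IHz := fresh "IHz" in
  elim/tens_ind: x => [u v|y z IHy IHz];
  last by rewrite ?(linearD, tensDl, tensDr, scalerDl, scalerDr) /=
    ?(linearD, tensDl, tensDr, scalerDl, scalerDr) /=
    ?(linearD, tensDl, tensDr, scalerDl, scalerDr) /= ?IHy ?IHz.

Section Coalgebras.
Variable K : fieldType.

Record coalg := Coalg {
  coalg_car :> lmodType K;
  cmul : {linear coalg_car -> tensor coalg_car coalg_car};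
  cone : {linear coalg_car -> K^o};
  cmulA : forall x, tassoc (tmap cmul idfun (cmul x)) = tmap idfun cmul (cmul x);
  cmul1l : forall x, tlift (fun a b => cone a *: b) (cmul x) = x;
  cmulC : forall x, tswap (cmul x) = cmul x }.

Arguments cmul : clear implicits.
Arguments cone : clear implicits.

Lemma bilin_scale (U V : lmodType K) (e : {linear U -> K^o}) :
  bilin (fun (a : U) (b : V) => (e a : K) *: b).
Proof.
split=> z a x y; last by rewrite scalerDr !scalerA mulrC.
by rewrite linearP scalerDl scalerA.
Qed.

Definition escale (U V : lmodType K) (e : {linear U -> K^o}) : tensor U V -> V :=
  tlin (bilin_scale V e).
HB.instance Definition _ U V e := GRing.Linear.on (@escale U V e).

Lemma escaleE (U V : lmodType K) (e : {linear U -> K^o}) u (v : V) :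
  escale e (u *t v) = (e u : K) *: v.
Proof. by rewrite /escale /tlin tliftE //; apply: bilin_scale. Qed.

Lemma cmul1 (C : coalg) (x : C) : escale (cone C) (cmul C x) = x.
Proof. exact: cmul1l. Qed.

Lemma cmul1r (C : coalg) (x : C) : escale (cone C) (tswap (cmul C x)) = x.
Proof. by rewrite cmulC cmul1. Qed.

Record coalgHom (C D : coalg) := CoalgHom {
  chom_fun :> {linear C -> D};
  chom_mul : forall x, cmul D (chom_fun x) = tmap chom_fun chom_fun (cmul C x);
  chom_one : forall x, cone D (chom_fun x) = cone C x }.

Lemma linear_eq (U V : lmodType K) (f g : {linear U -> V}) : f =1 g -> f = g.
Proof.
case: f g => [f cf] [g cg] /= fg; have e : f = g by apply: funext.
case: g / e cg {fg} => cg; congr GRing.Linear.Pack.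
case: cf => [[p1] [p2]]; case: cg => [[q1] [q2]].
by congr GRing.Linear.Class; congr (_ _); apply: Prop_irrelevance.
Qed.

Lemma coalgHom_eq C D (f g : coalgHom C D) : f =1 g -> f = g.
Proof.
case: f g => [f f1 f2] [g g1 g2] /= /linear_eq e.
by case: g / e g1 g2 => g1 g2; congr CoalgHom; apply: Prop_irrelevance.
Qed.

Lemma cid_mul (C : coalg) x : cmul C (idfun x) = tmap idfun idfun (cmul C x).
Proof. by rewrite tmap_id. Qed.

Definition cidm (C : coalg) : coalgHom C C :=
  @CoalgHom C C idfun (@cid_mul C) (fun=> erefl).

Lemma ccomp_mul (A B C : coalg) (g : coalgHom B C) (f : coalgHom A B) x :
  cmul C ((g \o f) x) = tmap (g \o f) (g \o f) (cmul A x).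
Proof. by rewrite /= !chom_mul tmap_comp. Qed.

Lemma ccomp_one (A B C : coalg) (g : coalgHom B C) (f : coalgHom A B) x :
  cone C ((g \o f) x) = cone A x.
Proof. by rewrite /= !chom_one. Qed.

Definition ccomp (A B C : coalg) (g : coalgHom B C) (f : coalgHom A B) :
  coalgHom A C := @CoalgHom A C (g \o f) (ccomp_mul g f) (ccomp_one g f).

Local Notation "g \@ f" := (ccomp g f) (at level 50, left associativity).

Lemma ccompA (A B C D : coalg) (h : coalgHom C D) (g : coalgHom B C)
  (f : coalgHom A B) : h \@ (g \@ f) = h \@ g \@ f.
Proof. exact: coalgHom_eq. Qed.

Lemma ccomp1m (A B : coalg) (f : coalgHom A B) : cidm B \@ f = f.
Proof. exact: coalgHom_eq. Qed.

Lemma ccompm1 (A B : coalg) (f : coalgHom A B) : f \@ cidm A = f.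
Proof. exact: coalgHom_eq. Qed.

Lemma unit_coalg1l (x : K^o) :
  tlift (fun a b : K^o => (a : K) *: b) (@unit_comul K x) = x.
Proof. exact: unit_mull. Qed.

Definition unit_coalg : coalg :=
  @Coalg K^o (@unit_comul K) idfun (@unit_comulA K) unit_coalg1l (@unit_comulC K).

Section TensorCoalgebra.
Variables C D : coalg.

Definition tcmul (x : tensor C D) : tensor (tensor C D) (tensor C D) :=
  mid (tmap (cmul C) (cmul D) x).
HB.instance Definition _ := GRing.Linear.copy tcmul
  (@mid K C C D D \o tmap (cmul C) (cmul D)).

Definition tcone (x : tensor C D) : K^o := cone D (escale (cone C) x).
HB.instance Definition _ := GRing.Linear.copy tcone
  (cone D \o @escale C D (cone C)).

Lemma tcmulE c d : tcmul (c *t d) = mid (cmul C c *t cmul D d).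
Proof. by rewrite /tcmul tmapE. Qed.

Lemma tconeE c d : tcone (c *t d) = (cone C c : K) * cone D d.
Proof. by rewrite /tcone escaleE linearZ. Qed.

(* Both sides of coassociativity factor through the triple coproducts of
   [C] and [D], by a permutation of the six tensor factors. *)
Lemma tcmulA x :
  tassoc (tmap tcmul idfun (tcmul x)) = tmap idfun tcmul (tcmul x).
Proof.
tensor_elim x c d.
pose shuf (y : tensor C (tensor C C)) (z : tensor D (tensor D D)) :=
  tmap idfun (@mid K C C D D) (mid (y *t z)).
transitivity (shuf (tassoc (tmap (cmul C) idfun (cmul C c)))
                   (tassoc (tmap (cmul D) idfun (cmul D d)))).
  rewrite tcmulE; move: (cmul C c) (cmul D d) => y z; rewrite /shuf.
  tensor_elim y c1 c2; tensor_elim z d1 d2.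
  rewrite midE !tmapE /= tcmulE; move: (cmul C c1) (cmul D d1) => y z.
  tensor_elim y c3 c4; tensor_elim z d3 d4.
  by rewrite midE !tassocE midE tmapE /= midE.
rewrite !cmulA tcmulE; move: (cmul C c) (cmul D d) => y z; rewrite /shuf.
tensor_elim y c1 c2; tensor_elim z d1 d2.
by rewrite midE !tmapE /= midE tmapE /= tcmulE.
Qed.

Lemma tcmul1 x : tlift (fun a b => tcone a *: b) (tcmul x) = x.
Proof.
rewrite -[LHS]/(escale tcone (tcmul x)).
tensor_elim x c d; rewrite tcmulE.
transitivity (escale (cone C) (cmul C c) *t escale (cone D) (cmul D d)); last first.
  by rewrite !cmul1.
move: (cmul C c) (cmul D d) => y z; tensor_elim y c1 c2; tensor_elim z d1 d2.
by rewrite midE !escaleE /= tconeE tensZl tensZr scalerA.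
Qed.

Lemma tcmulC x : tswap (tcmul x) = tcmul x.
Proof.
tensor_elim x c d; rewrite tcmulE -[in RHS](cmulC c) -[in RHS](cmulC d).
move: (cmul C c) (cmul D d) => y z; tensor_elim y c1 c2; tensor_elim z d1 d2.
by rewrite !(midE, tswapE).
Qed.

Definition tcoalg : coalg := @Coalg (tensor C D) tcmul tcone tcmulA tcmul1 tcmulC.

End TensorCoalgebra.
End Coalgebras.
Arguments cmul {K} c.
Arguments cone {K} c.
Notation "g \@ f" := (ccomp g f) (at level 50, left associativity).

(** * Products of coalgebras *)

Section Products.
Variable K : fieldType.
Implicit Types C D T : coalg K.

Definition tunassoc (U V W : lmodType K) (x : tensor U (tensor V W)) :
    tensor (tensor U V) W :=
  tswap (tassoc (tswap (tassoc (tswap x)))).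
HB.instance Definition _ U V W := GRing.Linear.copy (@tunassoc U V W)
  (@tswap K W (tensor U V) \o @tassoc K W U V \o @tswap K V (tensor W U)
   \o @tassoc K V W U \o @tswap K U (tensor V W)).

Lemma tunassocE (U V W : lmodType K) (u : U) (v : V) (w : W) :
  tunassoc (u *t (v *t w)) = u *t v *t w.
Proof. by rewrite /tunassoc !(tswapE, tassocE). Qed.

(** Rebrackets the fourfold coproduct so that its two middle factors come from a single coproduct,
    to which cocommutativity applies. *)
Lemma cmul4 C (t : C) :
  tmap (cmul C) (cmul C) (cmul C t) =
  tunassoc (tmap idfun (@tassoc K C C C \o tmap (cmul C) idfun \o cmul C)
    (cmul C t)).
Proof.
transitivity (tunassoc (tmap idfun (tmap idfun (cmul C)) (tmap idfun (cmul C) (cmul C t)))).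
  rewrite -cmulA; move: (cmul C t) => x; tensor_elim x a b.
  rewrite !tmapE /=; move: (cmul C a) => y; tensor_elim y c d.
  by rewrite tassocE !tmapE /= tmapE tunassocE.
rewrite tmap_comp; congr tunassoc; apply: eq_tmap => // x.
by rewrite /= cmulA.
Qed.

(* Cocommutativity is used here, to swap the two middle factors of the fourfold
   coproduct: this makes the comultiplication a coalgebra morphism. *)
Lemma cmul_mid C (t : C) :
  mid (tmap (cmul C) (cmul C) (cmul C t)) = tmap (cmul C) (cmul C) (cmul C t).
Proof.
rewrite cmul4; move: (cmul C t) => x; tensor_elim x a b.
rewrite !tmapE /=; move: (cmul C b) => y; tensor_elim y c d.
rewrite !tmapE /= -[in LHS](cmulC c); move: (cmul C c) => y; tensor_elim y e f.
by rewrite tswapE !tassocE !tunassocE midE.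
Qed.

Section Pairing.
Variables (T C D : coalg K) (u : coalgHom T C) (v : coalgHom T D).

Definition pair_fun (t : T) : tensor C D := tmap u v (cmul T t).
HB.instance Definition _ := GRing.Linear.copy pair_fun (tmap u v \o cmul T).

Lemma pair_mul t :
  cmul (tcoalg C D) (pair_fun t) = tmap pair_fun pair_fun (cmul T t).
Proof.
transitivity (tmap (tmap u v) (tmap u v) (mid (tmap (cmul T) (cmul T) (cmul T t)))).
  rewrite /pair_fun; move: (cmul T t) => x; tensor_elim x a b.
  rewrite !tmapE /= tcmulE !chom_mul.
  move: (cmul T a) (cmul T b) => y z.
  by tensor_elim y c d; tensor_elim z e f; rewrite !tmapE !midE !tmapE /= !tmapE.
by rewrite cmul_mid tmap_comp.
Qed.

Lemma pair_one t : cone (tcoalg C D) (pair_fun t) = cone T t.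
Proof.
rewrite /= /tcone -[RHS]/(cone T t) -[in RHS](cmul1 t) /pair_fun.
move: (cmul T t) => x; tensor_elim x a b.
by rewrite tmapE !escaleE !linearZ /= !chom_one.
Qed.

Definition cpair : coalgHom T (tcoalg C D) := 
  @CoalgHom K T (tcoalg C D) pair_fun pair_mul pair_one.

Lemma cpairE t : cpair t = tmap u v (cmul T t). Proof. by []. Qed.

End Pairing.

Lemma cone_cmul D (d : D) : cone D (escale (cone D) (cmul D d)) = cone D d.
Proof. by rewrite cmul1. Qed.

Section Projections.
Variables C D : coalg K.

Definition pr1_fun (x : tensor C D) : C := escale (cone D) (tswap x).
HB.instance Definition _ := GRing.Linear.copy pr1_fun
  (@escale K D C (cone D) \o @tswap K C D).

Lemma pr1_funE c d : pr1_fun (c *t d) = (cone D d : K) *: c.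
Proof. by rewrite /pr1_fun tswapE escaleE. Qed.

Lemma pr1_mul x : cmul C (pr1_fun x) = tmap pr1_fun pr1_fun (cmul (tcoalg C D) x).
Proof.
tensor_elim x c d; rewrite /= tcmulE pr1_funE linearZ /=.
rewrite -cone_cmul; move: (cmul C c) (cmul D d) => y z.
tensor_elim y a b; tensor_elim z e f.
rewrite midE tmapE /= !pr1_funE escaleE linearZ.
by rewrite tensZl tensZr scalerA.
Qed.

Lemma pr1_one x : cone C (pr1_fun x) = cone (tcoalg C D) x.
Proof.
tensor_elim x c d; rewrite pr1_funE linearZ /= tconeE.
exact: mulrC.
Qed.

Definition pr1 : coalgHom (tcoalg C D) C := 
  @CoalgHom K (tcoalg C D) C pr1_fun pr1_mul pr1_one.

Lemma pr2_mul x : cmul D (escale (cone C) x) =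
  tmap (escale (cone C)) (escale (cone C)) (cmul (tcoalg C D) x).
Proof.
tensor_elim x c d; rewrite /= tcmulE escaleE linearZ /=.
rewrite -cone_cmul; move: (cmul C c) (cmul D d) => y z.
tensor_elim y a b.
tensor_elim z e f; rewrite midE tmapE /= !escaleE linearZ.
by rewrite tensZl tensZr scalerA.
Qed.

Lemma pr2_one x : cone D (escale (cone C) x) = cone (tcoalg C D) x.
Proof. by []. Qed.

Definition pr2 : coalgHom (tcoalg C D) D := 
  @CoalgHom K (tcoalg C D) D (escale (cone C)) pr2_mul pr2_one.

End Projections.

Lemma pr1_pair T C D (u : coalgHom T C) (v : coalgHom T D) :
  pr1 C D \@ cpair u v = u.
Proof.
apply: coalgHom_eq => t; rewrite /= -[in RHS](cmul1r t) /pair_fun.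
move: (cmul T t) => x; tensor_elim x a b.
by rewrite tmapE pr1_funE tswapE escaleE linearZ /= chom_one.
Qed.

Lemma pr2_pair T C D (u : coalgHom T C) (v : coalgHom T D) :
  pr2 C D \@ cpair u v = v.
Proof.
apply: coalgHom_eq => t; rewrite /= -[in RHS](cmul1 t) /pair_fun.
move: (cmul T t) => x; tensor_elim x a b.
by rewrite tmapE !escaleE linearZ /= chom_one.
Qed.

(** Uniqueness of morphisms into the product rests on this: by the counit laws of both factors, the
    two projections pair to the identity. *)
Lemma tcmul_pr C D (x : tensor C D) :
  tmap (@pr1_fun C D) (escale (cone C)) (tcmul x) = x.
Proof.
tensor_elim x c d.
rewrite tcmulE -{2}(cmul1r c) -{2}(cmul1 d).
move: (cmul C c) (cmul D d) => y z; tensor_elim y a b; tensor_elim z e f.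
rewrite midE tmapE tswapE !escaleE /= pr1_funE escaleE.
by rewrite !(tensZl, tensZr) !scalerA mulrC.
Qed.

Lemma pair_eta T C D (h : coalgHom T (tcoalg C D)) :
  h = cpair (pr1 C D \@ h) (pr2 C D \@ h).
Proof.
apply: coalgHom_eq => t; rewrite -[LHS]tcmul_pr.
rewrite -[tcmul (h t)]/(cmul (tcoalg C D) (h t)) chom_mul.
exact: (@tmap_comp K _ _ _ _ _ _ (pr1 C D) h (pr2 C D) h).
Qed.

Lemma pair_inj T C D (h h' : coalgHom T (tcoalg C D)) :
  pr1 C D \@ h = pr1 C D \@ h' -> pr2 C D \@ h = pr2 C D \@ h' -> h = h'.
Proof. by move=> e1 e2; rewrite (pair_eta h) e1 e2 -pair_eta. Qed.

Lemma pair_comp T T' C D (u : coalgHom T C) (v : coalgHom T D)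
    (w : coalgHom T' T) : cpair u v \@ w = cpair (u \@ w) (v \@ w).
Proof. by apply: pair_inj; rewrite ccompA !(pr1_pair, pr2_pair). Qed.

Definition cprod C C' D D' (f : coalgHom C C') (g : coalgHom D D') :=
  cpair (f \@ pr1 C D) (g \@ pr2 C D).

Lemma cprodE C C' D D' (f : coalgHom C C') (g : coalgHom D D') c d :
  cprod f g (c *t d) = f c *t g d.
Proof.
have e x : tmap (f \@ pr1 C D) (g \@ pr2 C D) x =
    tmap f g (tmap (pr1 C D) (pr2 C D) x) by rewrite tmap_comp.
by rewrite cpairE e [X in tmap f g X]tcmul_pr tmapE.
Qed.

Definition to1 C : coalgHom C (unit_coalg K).
Proof.
refine (@CoalgHom K C (unit_coalg K) (cone C) _ (fun=> erefl)).
move=> x; rewrite -[in LHS](cmul1 x); move: (cmul C x) => y.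
tensor_elim y a b; first by rewrite escaleE linearZ /= /unit_comul tmapE
  (tensZ _ _ (1 : K^o)) [_ *: 1]mulr1.
Defined.

Lemma to1_uniq C (u : coalgHom C (unit_coalg K)) : u = to1 C.
Proof. by apply: coalgHom_eq => x; rewrite /= -(chom_one u). Qed.

Lemma cprod_pair T C C' D D' (f : coalgHom C C') (g : coalgHom D D')
    (u : coalgHom T C) (v : coalgHom T D) :
  cprod f g \@ cpair u v = cpair (f \@ u) (g \@ v).
Proof. by rewrite /cprod pair_comp -!ccompA pr1_pair pr2_pair. Qed.

(* Splitting of an idempotent [i \o r] on the coalgebra [C]. *)
Lemma retract_coalg C (L : lmodType K) (i : {linear L -> C}) (r : {linear C -> L}) :
  cancel i r ->
  (forall x, cmul C (i (r x)) = tmap (i \o r) (i \o r) (cmul C x)) ->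
  (forall x, cone C (i (r x)) = cone C x) ->
  exists (d : {linear L -> tensor L L}) (e : {linear L -> K^o}),
    [/\ [/\ forall x, tassoc (tmap d idfun (d x)) = tmap idfun d (d x),
            forall x, tlift (fun a b => e a *: b) (d x) = x &
            forall x, tswap (d x) = d x],
        forall x, cmul C (i x) = tmap i i (d x),
        forall x, d (r x) = tmap r r (cmul C x),
        forall x, cone C (i x) = e x & forall x, e (r x) = cone C x].
Proof.
move=> ir im i1.
pose d : {linear L -> tensor L L} := tmap r r \o (cmul C \o i).
pose e : {linear L -> K^o} := cone C \o i.
have ri x : tmap i i (d x) = cmul C (i x).
  by rewrite /= tmap_comp -im ir.
have dr y : tmap r r (cmul C y) = d (r y).
  rewrite /= im tmap_comp; apply: eq_tmap => z; by rewrite /= ir.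
have dA x : tassoc (tmap d idfun (d x)) = tmap idfun d (d x).
  rewrite [d x]/(tmap r r (cmul C (i x))) !tmap_comp.
  transitivity (tmap r (tmap r r) (tassoc (tmap (cmul C) idfun (cmul C (i x))))).
    move: (cmul C (i x)) => y; tensor_elim y a b.
    rewrite !tmapE [X in tassoc (X *t _)](_ : _ = tmap r r (cmul C a)); last by rewrite dr.
    by move: (cmul C a) => y; tensor_elim y c e0; rewrite ?tmapE !tassocE !tmapE /= tmapE.
  rewrite cmulA tmap_comp; apply: eq_tmap => // y; exact: dr.
have d1 x : tlift (fun a b => e a *: b) (d x) = x.
  rewrite -[LHS]/(escale e (d x)) -[RHS]ir -[in RHS](cmul1 (i x)) /=.
  move: (cmul C (i x)) => y; tensor_elim y a b.
  by rewrite tmapE !escaleE /= i1 linearZ.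
have dC x : tswap (d x) = d x.
  rewrite /= -[in RHS]cmulC; move: (cmul C (i x)) => y; tensor_elim y a b.
  by rewrite !(tmapE, tswapE).
by exists d, e; split=> // x; rewrite ?ri -?dr //=.
Qed.

End Products.

(** * Hopf algebras as group objects *)

Section HopfPoints.
Variable K : fieldType.
Implicit Types (A B : cocHopf K) (T : coalg K).

Definition coalg_of A : coalg K :=
  @Coalg K A (comul A) (counit A) (@comulA K A) (@counitl K A) (@comulC K A).

Section Mult.
Variable A : algType K.

Lemma bilin_mul : bilin (fun a b : A => a * b).
Proof.
split=> z a x y; first by rewrite mulrDl -scalerAl.
by rewrite mulrDr -scalerAr.
Qed.

Definition amul : tensor A A -> A := tlin bilin_mul.
HB.instance Definition _ := GRing.Linear.on amul.

Lemma amulE a b : amul (a *t b) = a * b.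
Proof. by rewrite /amul /tlin tliftE //; apply: bilin_mul. Qed.

Definition lmulr (y : tensor A A) (b : A) : tensor A A :=
  tmap idfun amul (tassoc (y *t b)).

Lemma lmulrE c d b : lmulr (c *t d) b = c *t (d * b).
Proof. by rewrite /lmulr tassocE tmapE /= amulE. Qed.

Lemma lmulr_linear y : linear (lmulr y).
Proof. by move=> a b c; rewrite /lmulr tensDr tensZr !linearP. Qed.

HB.instance Definition _ y :=
  GRing.isLinear.Build K A (tensor A A) *:%R (lmulr y) (lmulr_linear y).

Lemma lmulrD y z b : lmulr (y + z) b = lmulr y b + lmulr z b.
Proof. by rewrite /lmulr tensDl !linearD. Qed.

Lemma tlift_mulr (f : {linear A -> A}) (y : tensor A A) :
  tlift (fun a b => a * f b) y = amul (tmap idfun f y).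
Proof.
rewrite [y in RHS]tensE [tmap _ _ _]linear_sum [amul _]linear_sum; apply: eq_bigr => p _ /=.
by rewrite tmapE amulE.
Qed.

Lemma tlift_mull (f : {linear A -> A}) (y : tensor A A) :
  tlift (fun a b => f a * b) y = amul (tmap f idfun y).
Proof.
rewrite [y in RHS]tensE [tmap _ _ _]linear_sum [amul _]linear_sum; apply: eq_bigr => p _ /=.
by rewrite tmapE amulE.
Qed.

(** With [y] and [z] the coproducts of a and b, the left side is the shear of [a *t b], and the
    counit absorbs [z]. *)
Lemma tmap_mid_lmulr (e : {linear A -> K^o}) (y z : tensor A A) :
  tmap (@escale K A A e \o @tswap K A A) amul (mid (y *t z)) =
  lmulr y (escale e z).
Proof.
elim/tens_ind: y => [c d|y1 y2 IH1 IH2]; last first.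
  by rewrite lmulrD tensDl !linearD /= IH1 IH2.
tensor_elim z f g.
by rewrite midE tmapE /= tswapE !escaleE lmulrE amulE tensZl -scalerAr tensZr.
Qed.

End Mult.

Lemma tmul_mid (A : algType K) (y z : tensor A A) :
  tmul y z = tmap (@amul A) (@amul A) (mid (y *t z)).
Proof.
rewrite [y in RHS]tensE [z in RHS]tensE.
rewrite (big_morph (fun v => v *t _) (fun u v => tensDl u v _) (tens0l _ _)).
rewrite [mid _]linear_sum [tmap _ _ _]linear_sum; apply: eq_bigr => p _ /=.
rewrite (big_morph (fun v => _ *t v) (fun u v => tensDr _ u v) (tens0r _ _)).
rewrite [mid _]linear_sum [tmap _ _ _]linear_sum; apply: eq_bigr => q _ /=.
by rewrite midE tmapE /= !amulE.
Qed.

Lemma mulm_mul A (x : tensor A A) : comul A (amul x) =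
  tmap (@amul A) (@amul A) (cmul (tcoalg (coalg_of A) (coalg_of A)) x).
Proof.
by tensor_elim x a b; rewrite amulE comulM tmul_mid /= tcmulE.
Qed.

Lemma mulm_one A (x : tensor A A) :
  counit A (amul x) = cone (tcoalg (coalg_of A) (coalg_of A)) x.
Proof.
rewrite /=; tensor_elim x a b.
by rewrite amulE tconeE rmorphM.
Qed.

Definition mulm A : coalgHom (tcoalg (coalg_of A) (coalg_of A)) (coalg_of A) :=
  @CoalgHom K (tcoalg (coalg_of A) (coalg_of A)) (coalg_of A) (@amul A)
    (@mulm_mul A) (@mulm_one A).

Lemma mulmE A (a b : A) : mulm A (a *t b) = a * b.
Proof. exact: amulE. Qed.

Definition unitm A : coalgHom (unit_coalg K) (coalg_of A) :=
  @CoalgHom K (unit_coalg K) (coalg_of A) (of_unit_fun A)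
    (@of_unit_comul K A) (@of_unit_counit K A).

Section Antipode.
Variable A : cocHopf K.
Local Notation S := (antipode A).
Local Notation D := (comul A).

Lemma amul_antipoder (a : A) : amul (tmap idfun S (D a)) = (counit A a)%:A.
Proof. by rewrite -tlift_mulr antipoder. Qed.

Lemma amul_antipodel (a : A) : amul (tmap S idfun (D a)) = (counit A a)%:A.
Proof. by rewrite -tlift_mull antipodel. Qed.

(* The shear map [a *t b |-> a1 *t (a2 * b)] is a bijective coalgebra morphism;
   the antipode is a component of its inverse, hence a coalgebra morphism. *)
Definition shear : coalgHom (tcoalg (coalg_of A) (coalg_of A))
    (tcoalg (coalg_of A) (coalg_of A)) :=
  cpair (pr1 (coalg_of A) (coalg_of A)) (mulm A).

Lemma shearE a b : shear (a *t b) = lmulr (D a) b.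
Proof.
rewrite [LHS]/(tmap (pr1_fun (D:=coalg_of A)) (@amul A)
  (tcmul (C:=coalg_of A) (D:=coalg_of A) (a *t b))) tcmulE.
rewrite -[in RHS](@cmul1 K (coalg_of A) b).
exact: tmap_mid_lmulr.
Qed.

Definition unshear (x : tensor A A) : tensor A A :=
  tmap idfun (@amul A) (tassoc (tmap (tmap idfun S \o D) idfun x)).
HB.instance Definition _ := GRing.Linear.copy unshear
  (tmap idfun (@amul A) \o @tassoc K A A A \o tmap (tmap idfun S \o D) idfun).

Lemma unshearE a b : unshear (a *t b) = lmulr (tmap idfun S (D a)) b.
Proof. by rewrite /unshear tmapE. Qed.

(** On [a *t b] the claim is a1 *t (a2 S(a3) b) = a *t b: coassociativity, then the antipode axiom,
    then the counit. The auxiliary [e1] and [e2] replace the coproduct of a by an arbitrary tensor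
    [y], so that they can be checked on pure tensors. *)
Lemma shear_unshear x : shear (unshear x) = x.
Proof.
tensor_elim x a b; rewrite unshearE.
have e1 y : shear (lmulr (tmap idfun S y) b) =
    lmulr (tmap idfun (@amul A \o tmap idfun S) (tassoc (tmap D idfun y))) b.
  elim/tens_ind: y => [c d|y z Iy Iz].
    rewrite !tmapE lmulrE shearE /=; move: (D c) => y.
    elim/tens_ind: y => [e f|y z Iy Iz].
      by rewrite tassocE tmapE /= tmapE amulE !lmulrE mulrA.
    by rewrite tensDl !linearD /= !lmulrD Iy Iz.
  by rewrite !linearD /= !lmulrD !linearD /= Iy Iz.
rewrite e1 [tassoc _](@cmulA K (coalg_of A)) /= tmap_comp.
rewrite (eq_tmap (f' := idfun) (g' := fun a => (counit A a)%:A) _ _) //; last first.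
  exact: amul_antipoder.
rewrite -[in RHS](@cmul1r K (coalg_of A) a) /=.
have e2 y : lmulr (tmap idfun (of_unit A \o counit A) y) b =
   escale (counit A) (tswap y) *t b.
  elim/tens_ind: y => [c d|y z Iy Iz]; last by rewrite !linearD /= lmulrD tensDl Iy Iz.
  by rewrite tmapE lmulrE tswapE escaleE /= -scalerAl mul1r tensZr tensZl.
exact: e2.
Qed.

Lemma unshear_shear x : unshear (shear x) = x.
Proof.
tensor_elim x a b; rewrite shearE.
have e1 y : unshear (lmulr y b) =
    lmulr (tmap idfun (@amul A \o tmap S idfun) (tassoc (tmap D idfun y))) b.
  elim/tens_ind: y => [c d|y z Iy Iz].
    rewrite !tmapE lmulrE unshearE /=; move: (D c) => y.
    elim/tens_ind: y => [e f|y z Iy Iz].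
      by rewrite tassocE !tmapE /= tmapE amulE !lmulrE mulrA.
    by rewrite tensDl !linearD /= !lmulrD Iy Iz.
  by rewrite !linearD /= !lmulrD !linearD /= Iy Iz.
rewrite e1 [tassoc _](@cmulA K (coalg_of A)) /= tmap_comp.
rewrite (eq_tmap (f' := idfun) (g' := fun a => (counit A a)%:A) _ _) //; last first.
  exact: amul_antipodel.
rewrite -[in RHS](@cmul1r K (coalg_of A) a) /=.
have e2 y : lmulr (tmap idfun (of_unit A \o counit A) y) b =
   escale (counit A) (tswap y) *t b.
  elim/tens_ind: y => [c d|y z Iy Iz]; last by rewrite !linearD /= lmulrD tensDl Iy Iz.
  by rewrite tmapE lmulrE tswapE escaleE /= -scalerAl mul1r tensZr tensZl.
exact: e2.
Qed.

End Antipode.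

End HopfPoints.

(** * Convolution groups of points *)

Section PointGroup.
Variable K : fieldType.
Implicit Types (A B : cocHopf K) (T C D : coalg K).

Lemma inverse_coalgHom C D (f : coalgHom C D) (g : {linear D -> C}) :
  cancel f g -> cancel g f -> exists h : coalgHom D C, h =1 g.
Proof.
move=> fK gK.
have gm x : cmul C (g x) = tmap g g (cmul D x).
  rewrite -[in RHS](gK x) chom_mul tmap_comp -[LHS]tmap_id.
  by apply: eq_tmap => y /=; rewrite fK.
have g1 x : cone C (g x) = cone D x by rewrite -[in RHS](gK x) chom_one.
by exists (CoalgHom gm g1).
Qed.

(* The [T]-points of [A], a group under convolution: [A] is a group object in
   the cartesian category of cocommutative coalgebras. *)
Definition pts T A := coalgHom T (coalg_of A).
HB.instance Definition _ T A := gen_eqMixin (pts T A).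
HB.instance Definition _ T A := gen_choiceMixin (pts T A).

Definition ptmul T A (a b : pts T A) : pts T A := mulm A \@ cpair a b.
Definition ptone T A : pts T A := unitm A \@ to1 T.

Lemma ptmulE T A (a b : pts T A) t : ptmul a b t = amul (tmap a b (cmul T t)).
Proof. by []. Qed.

Lemma ptoneE T A t : ptone T A t = (cone T t)%:A.
Proof. by []. Qed.

Lemma antipode_hom_ex A : exists S : coalgHom (coalg_of A) (coalg_of A), S =1 antipode A.
Proof.
have [h hE] : exists h : coalgHom (tcoalg (coalg_of A) (coalg_of A))
    (tcoalg (coalg_of A) (coalg_of A)), h =1 @unshear K A.
  pose g : {linear tensor A A -> tensor A A} := @unshear K A.
  exact: (@inverse_coalgHom _ _ (shear A) g (@unshear_shear K A) (@shear_unshear K A)).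
(* The pairing sends a to [a *t 1], whose image under the inverse shear is a1 *t S(a2); the second
   projection leaves S(a). *)
exists (pr2 _ _ \@ h \@ cpair (cidm _) (ptone _ A)) => a.
have lmulr1 y : lmulr y (1 : A) = y.
  elim/tens_ind: y => [b c|y z Iy Iz]; last by rewrite lmulrD Iy Iz.
  by rewrite lmulrE mulr1.
have e1 (y : tensor A A) : unshear (tmap idfun (of_unit A \o counit A) y) =
   tmap idfun (antipode A) (comul A (escale (counit A) (tswap y))).
  elim/tens_ind: y => [b c|y z Iy Iz]; last by rewrite !linearD /= Iy Iz.
  rewrite tmapE tswapE escaleE /= /of_unit_fun tensZr !linearZ /=.
  by rewrite unshearE lmulr1.
have e2 (y : tensor A A) : escale (counit A) (tmap idfun (antipode A) y) =
    antipode A (escale (counit A) y).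
  tensor_elim y b c.
  by rewrite tmapE !escaleE linearZ.
transitivity (escale (counit A) (unshear (tmap idfun (of_unit A \o counit A) (comul A a)))).
  exact: (congr1 (escale (counit A)) (hE _)).
rewrite e1 e2 [escale _ (tswap _)](@cmul1r K (coalg_of A)).
by rewrite [escale _ _](@cmul1 K (coalg_of A)).
Qed.

Definition antipode_hom A : coalgHom (coalg_of A) (coalg_of A) := sval (cid (antipode_hom_ex A)).

Lemma antipode_homE A : antipode_hom A =1 antipode A.
Proof. exact: svalP (cid (antipode_hom_ex A)). Qed.

Definition ptinv T A (a : pts T A) : pts T A := antipode_hom A \@ a.

Lemma ptmulA T A : associative (@ptmul T A).
Proof.
move=> a b c; apply: coalgHom_eq => t; rewrite !ptmulE.
transitivity (amul (tmap idfun (@amul K A)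
    (tmap a (tmap b c) (tmap idfun (cmul T) (cmul T t))))).
  congr amul; rewrite tmap_comp tmap_comp; exact: eq_tmap.
transitivity (amul (tmap (@amul K A) idfun
    (tmap (tmap a b) c (tmap (cmul T) idfun (cmul T t))))); last first.
  congr amul; rewrite tmap_comp tmap_comp; exact: eq_tmap.
rewrite -cmulA; move: (tmap (cmul T) idfun _) => x; tensor_elim x y w; tensor_elim y u v.
by rewrite tassocE !tmapE /= !tmapE /= !amulE mulrA.
Qed.

Lemma ptmul1 T A : left_id (ptone T A) (@ptmul T A).
Proof.
move=> a; apply: coalgHom_eq => t; rewrite ptmulE -[in RHS](cmul1 t).
move: (cmul T t) => x; tensor_elim x u v.
by rewrite tmapE amulE escaleE linearZ /= -scalerAl mul1r.
Qed.

Lemma ptmulr1 T A : right_id (ptone T A) (@ptmul T A).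
Proof.
move=> a; apply: coalgHom_eq => t; rewrite ptmulE -[in RHS](cmul1r t).
move: (cmul T t) => x; tensor_elim x u v.
by rewrite tmapE tswapE amulE escaleE linearZ /= -scalerAr mulr1.
Qed.

Lemma ptmulV T A : left_inverse (ptone T A) (@ptinv T A) (@ptmul T A).
Proof.
move=> a; apply: coalgHom_eq => t; rewrite ptmulE ptoneE.
transitivity (amul (tmap (antipode A) idfun (tmap a a (cmul T t)))).
  by rewrite tmap_comp; congr amul; apply: eq_tmap => // u; rewrite /= antipode_homE.
rewrite -chom_mul [tmap _ _ _](_ : _ = tmap (antipode A) idfun (comul A (a t))) //.
by rewrite amul_antipodel -(chom_one a).
Qed.

Lemma ptmulrV T A : right_inverse (ptone T A) (@ptinv T A) (@ptmul T A).
Proof.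
move=> a; apply: coalgHom_eq => t; rewrite ptmulE ptoneE.
transitivity (amul (tmap idfun (antipode A) (tmap a a (cmul T t)))).
  by rewrite tmap_comp; congr amul; apply: eq_tmap => // u; rewrite /= antipode_homE.
rewrite -chom_mul [tmap _ _ _](_ : _ = tmap idfun (antipode A) (comul A (a t))) //.
by rewrite amul_antipoder -(chom_one a).
Qed.

HB.instance Definition _ T A := isGroup.Build (pts T A)
  (@ptmulA T A) (@ptmul1 T A) (@ptmulr1 T A) (@ptmulV T A) (@ptmulrV T A).

Definition ptcomp T T' A (a : pts T A) (u : coalgHom T' T) : pts T' A := a \@ u.

Lemma ptcompM T T' A (a b : pts T A) (u : coalgHom T' T) :
  ptcomp (a * b)%g u = (ptcomp a u * ptcomp b u)%g.
Proof.
transitivity (mulm A \@ (cpair a b \@ u)); first exact: coalgHom_eq.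
by rewrite pair_comp.
Qed.

Lemma ptcomp1 T T' A (u : coalgHom T' T) : ptcomp (1 : pts T A)%g u = 1%g.
Proof.
transitivity (unitm A \@ (to1 T \@ u)); first exact: coalgHom_eq.
by rewrite [to1 T \@ u]to1_uniq.
Qed.

Lemma ptcompV T T' A (a : pts T A) (u : coalgHom T' T) :
  ptcomp (a^-1)%g u = ((ptcomp a u)^-1)%g.
Proof. exact: coalgHom_eq. Qed.

Definition coalg_hom A B (f : bialgHom A B) : coalgHom (coalg_of A) (coalg_of B) :=
  @CoalgHom K (coalg_of A) (coalg_of B) f (bialg_comul f) (bialg_counit f).

Definition ptmap T A B (f : bialgHom A B) (a : pts T A) : pts T B := coalg_hom f \@ a.

Lemma ptmapM T A B (f : bialgHom A B) (a b : pts T A) :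
  ptmap f (a * b)%g = (ptmap f a * ptmap f b)%g.
Proof.
have key (g : {lrmorphism A -> B}) x :
    g (amul (tmap a b x)) = amul (tmap (g \o a) (g \o b) x).
  elim/tens_ind: x => [u v|y z IHy IHz]; last by rewrite !linearD /= IHy IHz.
  by rewrite !tmapE !amulE rmorphM.
apply: coalgHom_eq => t; exact: key.
Qed.

Lemma ptmap1 T A B (f : bialgHom A B) : ptmap f (1 : pts T A)%g = 1%g.
Proof. by apply: (mulgI (ptmap f 1%g)); rewrite -ptmapM !mulg1. Qed.

Lemma ptmapV T A B (f : bialgHom A B) (a : pts T A) :
  ptmap f (a^-1)%g = ((ptmap f a)^-1)%g.
Proof. by apply: (mulgI (ptmap f a)); rewrite -ptmapM !mulgV ptmap1. Qed.

Lemma ptmap_comp T A B A' (g : bialgHom B A') (f : bialgHom A B) (a : pts T A) :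
  ptmap (bialg_comp g f) a = ptmap g (ptmap f a).
Proof. exact: coalgHom_eq. Qed.

Lemma ptmap_id T A (a : pts T A) : ptmap (bialg_id A) a = a.
Proof. exact: coalgHom_eq. Qed.

Lemma ptmap_ptcomp T T' A B (f : bialgHom A B) (a : pts T A) (u : coalgHom T' T) :
  ptcomp (ptmap f a) u = ptmap f (ptcomp a u).
Proof. exact: coalgHom_eq. Qed.

(** Multiplicativity is tested on the generic pair of points, the two projections of the tensor
    square of [A]. The unit is preserved because the image of the neutral point is an idempotent of
    a group. *)
Lemma bialg_of_coalg A B (f : coalgHom (coalg_of A) (coalg_of B)) :
  (forall T (a b : pts T A), f \@ (a * b)%g = ((f \@ a : pts T B) * (f \@ b))%g) ->
  exists h : bialgHom A B, coalg_hom h = f.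
Proof.
move=> fM.
have fm : {morph f : x y / (x : A) * (y : A) >-> (x : B) * (y : B)}.
  move=> x y.
  transitivity (f (mulm A (cprod (cidm (coalg_of A)) (cidm (coalg_of A)) (x *t y)))).
    by rewrite cprodE mulmE.
  transitivity (mulm B (cprod f f (x *t y))); last by rewrite cprodE mulmE.
  have e := fM _ (pr1 (coalg_of A) (coalg_of A)) (pr2 (coalg_of A) (coalg_of A)).
  exact: (congr1 (fun h : coalgHom (tcoalg (coalg_of A) (coalg_of A)) (coalg_of B)
    => h (x *t y)) e).
have f1 : f (1 : A) = 1 :> B.
  pose w : pts (unit_coalg K) B := f \@ (1 : pts (unit_coalg K) A)%g.
  have e : w = 1%g by apply: (mulgI w); rewrite mulg1 /w -fM mulg1.
  have /(congr1 (fun h : coalgHom (unit_coalg K) (coalg_of B) => h (1 : K^o))) := e.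
  by rewrite /= /of_unit_fun !scale1r.
pose f' : {linear A -> B} := chom_fun f.
pose mf := GRing.isMonoidMorphism.Build A B f' (conj f1 fm).
pose g : {lrmorphism A -> B} := HB.pack (GRing.Linear.sort f') mf.
by exists (@BialgHom K A B g (chom_mul f) (chom_one f)); apply: coalgHom_eq.
Qed.

End PointGroup.

(** * From group objects in coalgebras to Hopf algebras *)

Section GroupObjects.
Variable K : fieldType.
Implicit Types (T C D : coalg K).

Section FromElements.
Variables (C : coalg K) (m : coalgHom (tcoalg C C) C)
  (e : coalgHom (unit_coalg K) C) (S : coalgHom C C).
Let u : C := e (1 : K^o).
Hypothesis mA : forall x y z, m (x *t m (y *t z)) = m (m (x *t y) *t z).
Hypothesis m1 : forall x, m (u *t x) = x.
Hypothesis mr1 : forall x, m (x *t u) = x.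
Hypothesis mS : forall x, m (tmap S idfun (cmul C x)) = (cone C x : K) *: u.
Hypothesis mrS : forall x, m (tmap idfun S (cmul C x)) = (cone C x : K) *: u.

(** The algebra has the carrier of [C] itself, and [j], [j'] are identities. They are kept abstract
    so that the module structures of the algebra and of [C] never have to be unified later. *)
Lemma algebra_of_elements : exists (A : algType K) (j : {linear A -> C})
    (j' : {linear C -> A}),
  [/\ cancel j j', cancel j' j, forall x y, j (x * y) = m (j x *t j y) & j 1 = u].
Proof.
have mDl : left_distributive (fun x y : C => m (x *t y)) +%R.
  by move=> x y z; rewrite tensDl linearD.
have mDr : right_distributive (fun x y : C => m (x *t y)) +%R.
  by move=> x y z; rewrite tensDr linearD.
have u1 : cone C u = 1 by rewrite /u chom_one.
have u0 : u != 0.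
  by apply/eqP => u0; have := u1; rewrite u0 linear0 => /esym/eqP; rewrite oner_eq0.
pose ringm := GRing.Zmodule_isNzRing.Build C mA m1 mr1 mDl mDr u0.
pose R : nzRingType := HB.pack (GRing.Lmodule.sort C) ringm.
have ZAl (a : K) (x y : C) : a *: m (x *t y) = m ((a *: x) *t y).
  by rewrite tensZl linearZ.
have ZAr (a : K) (x y : C) : a *: m (x *t y) = m (x *t (a *: y)).
  by rewrite tensZr linearZ.
pose lalgm := GRing.Lmodule_isLalgebra.Build K R ZAl.
pose LA : lalgType K := HB.pack (GRing.NzRing.sort R) lalgm (GRing.Lmodule.class C).
pose algm := GRing.Lalgebra_isAlgebra.Build K LA ZAr.
pose A : algType K := HB.pack (GRing.Lalgebra.sort LA) algm.
by exists A, (idfun : {linear C -> C}), (idfun : {linear C -> C}).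
Qed.

Lemma hopf_of_elements : exists (H : cocHopf K) (f : coalgHom (coalg_of H) C)
    (g : coalgHom C (coalg_of H)),
  [/\ f \@ g = cidm C, g \@ f = cidm (coalg_of H) &
      forall T (a b : pts T H), f \@ (a * b)%g = m \@ cpair (f \@ a) (f \@ b)].
Proof.
have [A [j [j' [jK jK' jM j1]]]] := algebra_of_elements.
have jjm x : cmul C (j (j' x)) = tmap (j \o j') (j \o j') (cmul C x).
  by rewrite jK' -[LHS]tmap_id; apply: eq_tmap => y; rewrite /= jK'.
have jj1 x : cone C (j (j' x)) = cone C x by rewrite jK'.
(* The coalgebra structure of [C] is transported to [A] as a retract whose idempotent is the
   identity. *)
have [d [e' [[dA d1 dC] dj dj' ej ej']]] := retract_coalg jK jjm jj1.
have u1 : cone C u = 1 by rewrite /u chom_one.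
have e1 : e' 1 = 1 by rewrite -ej j1.
have eM : {morph e' : x y / x * y}.
  by move=> x y; rewrite -!ej jM chom_one /= tconeE.
pose em := GRing.isMonoidMorphism.Build A K^o e' (conj e1 eM).
pose ee : {lrmorphism A -> K^o} := HB.pack (GRing.Linear.sort e') em.
have dd1 : d 1 = 1 *t 1.
  rewrite -[1 in LHS]jK j1 dj' /u chom_mul /= /unit_comul !tmapE.
  by rewrite -/u -j1 jK.
have ddM x y : d (x * y) = tmul (d x) (d y).
  rewrite tmul_mid -[x * y]jK dj' jM chom_mul /= tcmulE !dj.
  move: (d x) (d y) => v w; tensor_elim v a b; tensor_elim w a' b'.
  by rewrite !tmapE !midE !tmapE /= ?tmapE /= -!jM !jK !amulE.
have jamul x : j (amul x) = m (tmap j j x).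
  by tensor_elim x a b; rewrite tmapE amulE jM.
pose s : {linear A -> A} := j' \o S \o j.
have sl x : tlift (fun a b => s a * b) (d x) = (ee x)%:A.
  rewrite tlift_mull; apply: (can_inj jK); rewrite jamul linearZ /= j1 -ej -mS dj.
  rewrite !tmap_comp; congr (m _); apply: eq_tmap => // a; exact: jK'.
have sr x : tlift (fun a b => a * s b) (d x) = (ee x)%:A.
  rewrite tlift_mulr; apply: (can_inj jK); rewrite jamul linearZ /= j1 -ej -mrS dj.
  rewrite !tmap_comp; congr (m _); apply: eq_tmap => // a; exact: jK'.
have d1r x : tlift (fun a b => ee b *: a) (d x) = x.
  rewrite -[RHS]d1 -[RHS]/(escale e' (d x)) -[in RHS]dC.
  rewrite [d x in RHS]tensE [tswap _]linear_sum [escale _ _]linear_sum.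
  by apply: eq_bigr => p _; rewrite /= tswapE escaleE.
pose H := @CocHopf K A d ee s dd1 ddM dA d1 d1r sl sr dC.
pose f := @CoalgHom K (coalg_of H) C j dj ej.
pose g := @CoalgHom K C (coalg_of H) j' dj' ej'.
exists H, f, g; split; first by apply: coalgHom_eq => x; rewrite /= jK'.
  by apply: coalgHom_eq => x; rewrite /= jK.
move=> T a b; apply: coalgHom_eq => t.
transitivity (m (tmap j j (tmap a b (cmul T t)))); first exact: jamul.
by rewrite tmap_comp.
Qed.

End FromElements.

(** When [f] and [g] are the projections and [h] is the identity, this evaluates the associator as a
    morphism of coalgebras. It lets associativity on points be read on pure tensors. *)
Lemma cpair_assocE (W Z C D E : coalg K) (f : coalgHom W C) (g : coalgHom W D)
    (h : coalgHom Z E) w z :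
  cpair (f \@ pr1 W Z) (cprod g h) (w *t z) = tassoc (cpair f g w *t h z).
Proof.
suff key (k : {linear tensor W Z -> tensor D E}) (y : tensor W W) (v : tensor Z Z) :
    (forall a b, k (a *t b) = g a *t h b) ->
    tmap (f \o @pr1_fun K W Z) k (mid (y *t v)) =
    tassoc (tmap f g y *t h (escale (cone Z) v)).
  transitivity (tassoc (tmap f g (cmul W w) *t h (escale (cone Z) (cmul Z z)))).
    pose k : {linear tensor W Z -> tensor D E} := cprod g h.
    rewrite -(key k); last exact: cprodE.
    by rewrite -tcmulE.
  by rewrite cmul1.
move=> kE; elim/tens_ind: y => [a b|y y' IHy IHy']; last first.
  by rewrite !(linearD, tensDl) /= IHy IHy'.
elim/tens_ind: v => [c d|v v' IHv IHv']; last first.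
  by rewrite !(linearD, tensDr) /= IHv IHv'.
rewrite midE !tmapE /= kE pr1_funE escaleE tassocE !linearZ /=.
by rewrite tensZl !tensZr.
Qed.

Section FromFunctor.
Variables (C : coalg K) (mul : forall T, coalgHom T C -> coalgHom T C -> coalgHom T C)
  (one : forall T, coalgHom T C) (inv : forall T, coalgHom T C -> coalgHom T C).
Hypothesis mulA : forall T, associative (@mul T).
Hypothesis mul1 : forall T, left_id (one T) (@mul T).
Hypothesis mulr1 : forall T, right_id (one T) (@mul T).
Hypothesis mulV : forall T, left_inverse (one T) (@inv T) (@mul T).
Hypothesis mulrV : forall T, right_inverse (one T) (@inv T) (@mul T).
Hypothesis mul_nat : forall T T' (a b : coalgHom T C) (w : coalgHom T' T),
  mul a b \@ w = mul (a \@ w) (b \@ w).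
Hypothesis one_nat : forall T T' (w : coalgHom T' T), one T \@ w = one T'.

Let m := mul (pr1 C C) (pr2 C C).

Lemma mul_pair T (a b : coalgHom T C) : mul a b = m \@ cpair a b.
Proof. by rewrite mul_nat pr1_pair pr2_pair. Qed.

(** The Yoneda argument: the multiplication is the product of the two projections, the antipode is
    the inverse of the identity, and each law on elements is the law on points at a generic
    point. *)
Lemma hopf_of_functor : exists (H : cocHopf K) (f : coalgHom (coalg_of H) C)
    (g : coalgHom C (coalg_of H)),
  [/\ f \@ g = cidm C, g \@ f = cidm (coalg_of H) &
      forall T (a b : pts T H), f \@ (a * b)%g = mul (f \@ a) (f \@ b)].
Proof.
(* By naturality the neutral point over [T] factors through the one-dimensional coalgebra. *)
have oneE T t : one T t = (cone T t : K) *: one (unit_coalg K) (1 : K^o).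
  rewrite -(one_nat (to1 T)) -linearZ.
  by rewrite -[_ *: 1 in RHS]/((cone T t : K) * 1) GRing.mulr1.
have pp x y : cpair (pr1 C C) (pr2 C C) (x *t y) = x *t y.
  by have := cprodE (cidm C) (cidm C) x y; rewrite /cprod !ccomp1m.
have mA x y z : m (x *t m (y *t z)) = m (m (x *t y) *t z).
  pose q := pr1 (tcoalg C C) C; pose q3 := pr2 (tcoalg C C) C.
  transitivity (mul (pr1 C C \@ q) (mul (pr2 C C \@ q) q3) (x *t y *t z)).
    have -> : mul (pr1 C C \@ q) (mul (pr2 C C \@ q) q3) =
        m \@ (cprod (cidm C) m \@ cpair (pr1 C C \@ q) (cprod (pr2 C C) (cidm C))).
      by rewrite cprod_pair !mul_pair /cprod !ccomp1m.
    transitivity (m (cprod (cidm C) m (cpair (pr1 C C \@ q)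
      (cprod (pr2 C C) (cidm C)) (x *t y *t z)))); last by [].
    by rewrite cpair_assocE pp tassocE cprodE.
  rewrite mulA -mul_nat.
  have -> : mul (m \@ q) q3 = m \@ cprod m (cidm C) by rewrite mul_pair /cprod ccomp1m.
  transitivity (m (cprod m (cidm C) (x *t y *t z))); first by [].
  by rewrite cprodE.
have mE T (a b : coalgHom T C) t : m (tmap a b (cmul T t)) = mul a b t.
  by rewrite mul_pair.
pose u := one (unit_coalg K) (1 : K^o).
have m1 x : m (u *t x) = x.
  rewrite -[RHS]/(cidm C x) -(mul1 (cidm C)) -mE.
  rewrite -[in LHS](cmul1 x); move: (cmul C x) => y; congr (m _).
  by tensor_elim y a b; rewrite tmapE escaleE oneE tensZl tensZr.
have mr1 x : m (x *t u) = x.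
  rewrite -[RHS]/(cidm C x) -(mulr1 (cidm C)) -mE.
  rewrite -[in LHS](cmul1r x); move: (cmul C x) => y; congr (m _).
  by tensor_elim y a b; rewrite tmapE tswapE escaleE oneE tensZl tensZr.
have mV x : m (tmap (inv (cidm C)) idfun (cmul C x)) = (cone C x : K) *: u.
  by rewrite -oneE -(mulV (cidm C)) -mE.
have mrV x : m (tmap idfun (inv (cidm C)) (cmul C x)) = (cone C x : K) *: u.
  by rewrite -oneE -(mulrV (cidm C)) -mE.
have [H [f [g [fg gf fM]]]] := hopf_of_elements mA m1 mr1 mV mrV.
by exists H, f, g; split=> // T a b; rewrite fM mul_pair.
Qed.

End FromFunctor.

End GroupObjects.

(** * Separation by linear functionals *)

Section LinearAlgebra.
Variable K : fieldType.
Implicit Types V W U : lmodType K.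

Section Submodule.
Variables (U : lmodType K) (P : U -> Prop).
Hypothesis P0 : P 0.
Hypothesis PL : forall a x y, P x -> P y -> P (a *: x + y).

Definition submod_pred : {pred U} := fun x => `[< P x >].

Lemma submod_pred_closed : submod_closed submod_pred.
Proof.
split=> [|a x y]; first by apply/asboolP.
by move=> /asboolP Px /asboolP Py; apply/asboolP/PL.
Qed.

HB.instance Definition _ := GRing.isSubmodClosed.Build K U submod_pred
  submod_pred_closed.

Record submod := Submod { submod_val :> U; submod_valP : submod_val \in submod_pred }.
HB.instance Definition _ := [isSub for submod_val].
HB.instance Definition _ := [Choice of submod by <:].
HB.instance Definition _ := [SubChoice_isSubLmodule of submod by <:].

Lemma submoduleP : exists (L : lmodType K) (i : {linear L -> U}),
  [/\ injective i, forall x, P (i x) & forall y, P y -> exists x, i x = y].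
Proof.
exists submod, (val : {linear submod -> U}); split; first exact: val_inj.
  by move=> x; apply/asboolP/(submod_valP x).
by move=> y Py; exists (Submod (asboolT Py)).
Qed.

End Submodule.

Lemma linear_build V W (f : V -> W) : linear f -> exists g : {linear V -> W}, g =1 f.
Proof.
move=> fl; pose g : {linear V -> W} :=
  HB.pack f (GRing.isLinear.Build K V W *:%R f fl).
by exists g.
Qed.

(* By Zorn's lemma there is a maximal subspace avoiding [v]; it is a hyperplane,
   and [l] reads off the component along [v]. *)
Lemma functional_separation V (v : V) :
  (forall l : {linear V -> K^o}, l v = 0) -> v = 0.
Proof.
move=> lv; apply: contrapT => v0.
pose P (H : set V) := (forall a x y, H x -> H y -> H (a *: x + y)) /\ ~ H v.
have [F FP Ftot|A [[AL Av] Amax]] := @Zorn_bigcup V P.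
  split=> [a x y [X FX Xx] [Y FY Yy]|[X FX Xv]]; last by have [_] := FP X FX; apply.
  have [XY|YX] := Ftot X Y FX FY.
    by exists Y => //; apply: (FP Y FY).1 => //; apply: XY.
  by exists X => //; apply: (FP X FX).1 => //; apply: YX.
(* [P] does not ask for 0, so that the union of the empty chain qualifies. If 0 were missing, [A]
   would be empty and the zero subspace would be strictly larger. *)
have A0 : A 0.
  apply: contrapT => nA0; apply: (Amax [set 0]%classic).
    split=> [x Ax|]; last by move=> /(_ 0 erefl).
    by case: nA0; have := AL (-1) x x Ax Ax; rewrite scaleN1r addNr.
  split=> [a x y -> ->|/=]; first by rewrite scaler0 addr0.
  exact: v0.
have AZ a x : A x -> A (a *: x) by move=> Ax; rewrite -[_ *: _]addr0; apply: AL.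
have AB x y : A x -> A y -> A (x + y) by move=> Ax Ay; rewrite -[x]scale1r; apply: AL.
have split_v y : exists a : K, A (y - a *: v).
  have [Ay|nAy] := pselect (A y); first by exists 0; rewrite scale0r subr0.
  apply: contrapT => ny.
  (* The larger subspace is K y + A. If it contained v = a y + h with a != 0, then y - a^-1 v would
     lie in [A], against the choice of y. *)
  apply: (Amax [set z | exists a h, A h /\ z = a *: y + h]%classic).
    split=> [h Ah|sub]; first by exists 0, h; rewrite scale0r add0r.
    by apply: nAy; apply: sub; exists 1, 0; rewrite scale1r addr0.
  split=> [b _ _ [a [h [Ah ->]]] [a' [h' [Ah' ->]]]|[a [h [Ah ve]]]].
    exists (b * a + a'), (b *: h + h'); split; first exact: AL.
    by rewrite scalerDl scalerDr scalerA addrACA.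
  have [a0|a0] := eqVneq a 0.
    by apply: Av; rewrite ve a0 scale0r add0r.
  apply: ny; exists a^-1; rewrite ve scalerDr scalerA mulVf // scale1r opprD addNKr.
  by rewrite -scaleN1r scalerA; apply: AZ.
pose c y : K := sval (cid (split_v y)).
have cP y : A (y - c y *: v) := svalP (cid (split_v y)).
have cU y a : A (y - a *: v) -> c y = a.
  move=> Ay; apply/eqP; rewrite -subr_eq0; apply/eqP; apply: contrapT => /eqP ac.
  have e : y - a *: v + -1 *: (y - c y *: v) = (c y - a) *: v.
    by rewrite scaleN1r opprB addrC addrA subrK scalerBl.
  apply: Av; have := AZ (c y - a)^-1 _ (AB _ _ Ay (AZ (-1) _ (cP y))).
  by rewrite e scalerA mulVf // scale1r.
have cL : linear (c : V -> K^o).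
  move=> a x y; apply: cU.
  have := AL a _ _ (cP x) (cP y).
  by rewrite scalerBr addrACA -opprD scalerA -scalerDl.
have [l lE] := linear_build cL.
have := lv l; rewrite lE (cU v 1); last by rewrite scale1r subrr.
by move/eqP; rewrite oner_eq0.
Qed.

Lemma tclass_sum V W (s : seq (V * W)) : tclass s = \sum_(p <- s) p.1 *t p.2.
Proof.
elim: s => [|[v w] s IHs]; first by rewrite big_nil.
by rewrite big_cons -IHs [RHS]taddE.
Qed.

(* By induction on the number of pure tensors in a presentation of [x]: if
   [sigma i v != 0] for the first one [v *t w], then [w] is a combination of the
   other right-hand factors. *)
Lemma tensor_separation V W (I : Type) (sigma : I -> {linear V -> K^o}) :
  (forall v, (forall i, sigma i v = 0) -> v = 0) ->
  forall x : tensor V W, (forall i, escale (sigma i) x = 0) -> x = 0.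
Proof.
move=> sep x; rewrite -[x]treprK; move: (trepr x) => {x} s.
have [n] := ubnP (size s); elim: n s => // n IHn [//|[v w] s] /= le_s es.
have [v0|v0] := eqVneq v 0.
  have e : tclass ((v, w) :: s) = tclass s.
    by rewrite !tclass_sum big_cons v0 tens0l add0r.
  by rewrite e; apply: IHn => // i; rewrite -e.
have [i si] : exists i, sigma i v != 0.
  apply: contrapT => ns; move/eqP: v0; apply; apply: sep => i.
  by apply: contrapT => /eqP si; apply: ns; exists i.
pose a (p : V * W) : K := (sigma i v : K)^-1 * sigma i p.1.
have we : w = - \sum_(p <- s) a p *: p.2.
  have := es i; rewrite tclass_sum linear_sum big_cons /= escaleE.
  move/(congr1 (fun z => (sigma i v : K)^-1 *: z)).
  rewrite scaler0 scalerDr scalerA mulVf // scale1r scaler_sumr => /eqP.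
  rewrite addr_eq0 => /eqP->; congr (- _); apply: eq_bigr => p _.
  by rewrite escaleE scalerA.
have e : tclass ((v, w) :: s) = tclass [seq (p.1 - a p *: v, p.2) | p <- s].
  rewrite !tclass_sum big_cons big_map /=.
  rewrite [in LHS]we -scaleN1r tensZr.
  rewrite (big_morph (fun z => v *t z) (fun y z => tensDr v y z) (tens0r _ _)).
  rewrite scaler_sumr -big_split; apply: eq_bigr => p _ /=.
  by rewrite tensDl addrC -[- (_ *: _)]scaleN1r !tensZl tensZr.
by rewrite e; apply: IHn; rewrite ?size_map // => j; rewrite -e.
Qed.

End LinearAlgebra.

(** * Cofree coalgebras *)

Section CofreeCoalgebra.
Variables (K : fieldType) (V : lmodType K).
Variable good : forall C : coalg K, {linear C -> V} -> Prop.
Implicit Types C : coalg K.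

Definition word := seq {linear V -> K^o}.

(* [phi f [:: l1; ..; ln] c] is the sum of [l1 (f c1) * .. * ln (f cn)] over
   the iterated coproduct of [c]. *)
Fixpoint phi C (f : {linear C -> V}) (w : word) : {linear C -> K^o} :=
  if w is l :: w' then phi f w' \o (@escale K C C (l \o f) \o cmul C) else cone C.

(** Coassociativity contracted with two functionals: both sides are h(c1) g(c2) c3. Thus functionals
    act on [C] through their convolution product. *)
Lemma escale_cmul C (g h : {linear C -> K^o}) (c : C) :
  escale g (cmul C (escale h (cmul C c))) =
  escale (g \o (@escale K C C h \o cmul C)) (cmul C c).
Proof.
pose E (y : tensor C (tensor C C)) := escale g (escale h y).
transitivity (E (tmap idfun (cmul C) (cmul C c))).
  rewrite /E; move: (cmul C c) => y; tensor_elim y a b.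
  by rewrite tmapE /= !escaleE !linearZ.
rewrite -cmulA /E; move: (cmul C c) => y; tensor_elim y a b.
rewrite tmapE escaleE /=; move: (cmul C a) => y.
elim/tens_ind: y => [p q|y z IHy IHz]; last first.
  by rewrite tensDl !linearD /= IHy IHz scalerDl.
by rewrite tassocE /= !escaleE !linearZ /= escaleE scalerA.
Qed.

(** The reason for using words: a value at [w ++ w'] is a sum of products of values at [w] and at
    [w'], with c1 and c2 as arguments. This determines the coproduct on the span. *)
Lemma phi_cat C (f : {linear C -> V}) (w w' : word) c :
  phi f (w ++ w') c = phi f w' (escale (phi f w) (cmul C c)).
Proof.
elim: w c => [|l w IHw] c /=; first by rewrite cmul1.
by rewrite IHw escale_cmul.
Qed.

(** Being a proposition, it may quantify over all coalgebras [C] without raising the universe of the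
    resulting space. *)
Inductive word_span : (word -> K^o) -> Prop :=
| word_span0 : word_span 0
| word_spanL a F G : word_span F -> word_span G -> word_span (a *: F + G)
| word_span_phi C f (c : C) : good f -> word_span (fun w => phi f w c).

Lemma phi_nat C (D : coalg K) (f : {linear D -> V}) (h : coalgHom C D) w c :
  phi (f \o h) w c = phi f w (h c).
Proof.
elim: w c => [|l w IHw] c /=; first by rewrite chom_one.
rewrite IHw chom_mul; congr (phi f w _).
by move: (cmul C c) => y; tensor_elim y a b; rewrite tmapE !escaleE linearZ.
Qed.

Lemma phi_ext C (f g : {linear C -> V}) w c : f =1 g -> phi f w c = phi g w c.
Proof.
by move=> /linear_eq ->.
Qed.

(* [R] is the span, inside functions on words, of all the [phi f c] with [f] good.
   The coproduct is the unique one for which evaluating [d x] at [(w, w')] gives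
   [x] at [w ++ w']. *)
Lemma cofree_coalg : exists (R : coalg K) (iota : {linear R -> V}),
  [/\ forall C (f : {linear C -> V}), good f ->
        exists h : coalgHom C R, forall c, iota (h c) = f c,
      forall C (h h' : coalgHom C R),
        (forall c, iota (h c) = iota (h' c)) -> h = h' &
      forall (W : lmodType K) (h1 h2 : {linear R -> W}),
        (forall C (h : coalgHom C R), good (iota \o h) ->
          forall c, h1 (h c) = h2 (h c)) -> h1 =1 h2].
Proof.
have [L [i [i_inj iP Pi]]] := submoduleP word_span0 word_spanL.
have linear_ev w : linear (fun x : L => i x w) by move=> a x y; rewrite linearP.
pose ev w : {linear L -> K^o} := sval (cid (linear_build (linear_ev w))).
have evE w x : ev w x = i x w by exact: (svalP (cid (linear_build (linear_ev w)))).
have ev_sep x : (forall w, ev w x = 0) -> x = 0.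
  move=> x0; apply: i_inj; rewrite linear0; apply: funext => w.
  by rewrite -evE x0.
have ev2_sep (x y : tensor L L) :
    (forall w w', ev w' (escale (ev w) x) = ev w' (escale (ev w) y)) -> x = y.
  move=> xy; apply/eqP; rewrite -subr_eq0; apply/eqP.
  apply: (tensor_separation ev_sep) => w; apply: ev_sep => w'.
  by rewrite !linearB /= xy subrr.
have lift C f : @good C f -> exists p : {linear C -> L}, forall c w, i (p c) w = phi f w c.
  move=> gf.
  have ex c : exists x, i x = (fun w => phi f w c) by apply/Pi/word_span_phi.
  pose p c := sval (cid (ex c)).
  have pE c : i (p c) = fun w => phi f w c := svalP (cid (ex c)).
  have pl : linear p.
    move=> a c d; apply: i_inj; rewrite linearP !pE; apply: funext => w.
    exact: linearP.
  by have [q qE] := linear_build pl; exists q => c w; rewrite qE pE.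
have L_ind (Q : L -> Prop) : Q 0 -> (forall a x y, Q x -> Q y -> Q (a *: x + y)) ->
    (forall C f (p : {linear C -> L}), good f ->
       (forall c w, i (p c) w = phi f w c) -> forall c, Q (p c)) ->
    forall x, Q x.
  move=> Q0 QL QP.
  suff main F : word_span F -> forall x, i x = F -> Q x by move=> x; exact: (main _ (iP x) x).
  elim=> {F} [x|a F G gF IF gG IG x|C f c gf x] xE.
  - by rewrite (_ : x = 0) //; apply: i_inj; rewrite linear0.
  - have [y yE] := Pi _ gF; have [z zE] := Pi _ gG.
    rewrite (_ : x = a *: y + z); first by apply: QL; [exact: IF|exact: IG].
    by apply: i_inj; rewrite linearP yE zE.
  - have [p pE] := lift _ _ gf.
    rewrite (_ : x = p c); first exact: (QP _ _ _ gf pE c).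
    by apply: i_inj; rewrite xE; apply: funext => w; rewrite pE.
have ev_tmap C f (p : {linear C -> L}) y w w' : (forall c w, i (p c) w = phi f w c) ->
    ev w' (escale (ev w) (tmap p p y)) = phi f w' (escale (phi f w) y).
  move=> pE; tensor_elim y a b.
  by rewrite tmapE !escaleE !linearZ /= !evE !pE.
have [d dE] : exists d : {linear L -> tensor L L},
    forall x w w', ev w' (escale (ev w) (d x)) = i x (w ++ w').
  (* Existence is stable under linear combinations and holds on generators, where the coproduct of
     [C] is pushed forward; uniqueness, by [ev2_sep], then makes the chosen value linear in [x]. The
     map [iota] arises in the same way. *)
  have ex x : exists t : tensor L L,
      forall w w', ev w' (escale (ev w) t) = i x (w ++ w').
    elim/L_ind: x => [|a x y [t tE] [t' tE']|C f p gf pE c].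
    - by exists 0 => w w'; rewrite !linear0.
    - by exists (a *: t + t') => w w'; rewrite !linearP /= tE tE'.
    - by exists (tmap p p (cmul C c)) => w w'; rewrite pE phi_cat (ev_tmap _ f).
  pose d x := sval (cid (ex x)).
  have dE x : forall w w', ev w' (escale (ev w) (d x)) = i x (w ++ w') :=
    svalP (cid (ex x)).
  have dl : linear d.
    by move=> a x y; apply: ev2_sep => w w'; rewrite dE !linearP /= !dE.
  by have [g gE] := linear_build dl; exists g => x w w'; rewrite gE dE.
have d_nat C f (p : {linear C -> L}) c : (forall c w, i (p c) w = phi f w c) ->
    d (p c) = tmap p p (cmul C c).
  by move=> pE; apply: ev2_sep => w w'; rewrite dE (ev_tmap _ f) // pE phi_cat.
have e_nat C f (p : {linear C -> L}) c : (forall c w, i (p c) w = phi f w c) ->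
    ev [::] (p c) = cone C c.
  by move=> pE; rewrite evE pE.
(* The coalgebra axioms are linear in [x], and on a generator [p c] they are those of [C]
   transported along [p]. *)
have dA x : tassoc (tmap d idfun (d x)) = tmap idfun d (d x).
  elim/L_ind: x => [|a x y IHx IHy|C f p gf pE c]; first by rewrite !linear0.
    by rewrite !linearP /= IHx IHy.
  rewrite (d_nat _ f) // !tmap_comp.
  transitivity (tmap p (tmap p p) (tassoc (tmap (cmul C) idfun (cmul C c)))).
    transitivity (tassoc (tmap (tmap p p) p (tmap (cmul C) idfun (cmul C c)))).
      rewrite tmap_comp; congr tassoc; apply: eq_tmap => // b; exact: d_nat pE.
    move: (tmap (cmul C) idfun _) => y; tensor_elim y z b; tensor_elim z u v.
    by rewrite !tmapE /= tmapE !tassocE !tmapE /= tmapE.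
  by rewrite cmulA tmap_comp; apply: eq_tmap => // b; rewrite /= (d_nat _ f).
have d1 x : tlift (fun a b => ev [::] a *: b) (d x) = x.
  rewrite -[LHS]/(escale (ev [::]) (d x)).
  elim/L_ind: x => [|a x y IHx IHy|C f p gf pE c]; first by rewrite !linear0.
    by rewrite !linearP /= IHx IHy.
  rewrite (d_nat _ f) // -[in RHS](cmul1 c); move: (cmul C c) => y.
  by tensor_elim y a b; rewrite tmapE !escaleE linearZ /= (e_nat _ f).
have dC x : tswap (d x) = d x.
  elim/L_ind: x => [|a x y IHx IHy|C f p gf pE c]; first by rewrite !linear0.
    by rewrite !linearP /= IHx IHy.
  rewrite (d_nat _ f) // -[in RHS]cmulC; move: (cmul C c) => y.
  by tensor_elim y a b; rewrite !(tmapE, tswapE).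
pose R := Coalg dA d1 dC.
have phi1 C f l c : @phi C f [:: l] c = l (f c).
  rewrite /= -[in RHS](cmul1r c); move: (cmul C c) => y; tensor_elim y a b.
  by rewrite tswapE !escaleE !linearZ /= [RHS]mulrC.
have [iota iotaE] : exists iota : {linear L -> V},
    forall (l : {linear V -> K^o}) x, l (iota x) = i x [:: l].
  have ex x : exists v, forall l : {linear V -> K^o}, l v = i x [:: l].
    elim/L_ind: x => [|a x y [v vE] [v' vE']|C f p gf pE c].
    - by exists 0 => l; rewrite !linear0.
    - by exists (a *: v + v') => l; rewrite !linearP vE vE'.
    - by exists (f c) => l; rewrite pE phi1.
  pose g x := sval (cid (ex x)).
  have gE x : forall l : {linear V -> K^o}, l (g x) = i x [:: l] := svalP (cid (ex x)).
  have gl : linear g.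
    move=> a x y; apply/eqP; rewrite -subr_eq0; apply/eqP.
    apply: functional_separation => l.
    by rewrite linearB linearP /= !gE linearP subrr.
  by have [h hE] := linear_build gl; exists h => l x; rewrite hE gE.
have iota_p C f (p : {linear C -> L}) c : (forall c w, i (p c) w = phi f w c) ->
    iota (p c) = f c.
  move=> pE; apply/eqP; rewrite -subr_eq0; apply/eqP.
  by apply: functional_separation => l; rewrite linearB iotaE pE phi1 subrr.
(* An element of [R] is recovered from [iota] and the coproduct, which is why a morphism into [R] is
   determined by its composite with [iota]. *)
have phi_iota w x : phi (C := R) iota w x = i x w.
  elim: w x => [|l w IHw] x; first by rewrite /= evE.
  rewrite /= IHw -evE -[l :: w]/([:: l] ++ w) -dE; congr (ev w _).
  congr (escale _ _); apply: linear_eq => y.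
  by rewrite /= iotaE evE.
have hom_of C f (p : {linear C -> L}) : (forall c w, i (p c) w = phi f w c) ->
    exists h : coalgHom C R, forall c, h c = p c.
  move=> pE.
  by exists (@CoalgHom K C R p (fun c => d_nat C f p c pE) (fun c => e_nat C f p c pE)).
exists R, iota; split=> [C f gf|C h h' hh'|W h1 h2 h12 x].
- have [p pE] := lift _ _ gf; have [h hE] := hom_of _ _ _ pE.
  by exists h => c; rewrite hE; apply: iota_p.
- apply: coalgHom_eq => c; apply: i_inj; apply: funext => w.
  rewrite -!phi_iota -!(phi_nat (D := R)).
  exact: phi_ext.
- elim/L_ind: x => [|a x y IHx IHy|C f p gf pE c]; first by rewrite !linear0.
    by rewrite !linearP IHx IHy.
  have [h hE] := hom_of _ _ _ pE; rewrite -hE; apply: h12.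
  rewrite (_ : iota \o h = f :> {linear C -> V}) //.
  by apply: linear_eq => b; rewrite /= hE; apply: iota_p.
Qed.

End CofreeCoalgebra.

(** * The automorphism group of a Hopf algebra *)

Section JointlyEpic.
Variables (K : fieldType) (I : Type).
Implicit Types D Z : coalg K.

(** Tested on linear maps rather than on coalgebra morphisms: with [z] fixed, a linear map on
    [tensor D Z] is one on [D], whence stability under tensoring. *)
Definition jointly_epic D (C : I -> coalg K) (h : forall i, coalgHom (C i) D) :=
  forall (W : lmodType K) (f g : {linear D -> W}),
    (forall i c, f (h i c) = g (h i c)) -> f =1 g.

Lemma jointly_epic_tensor D Z C (h : forall i, coalgHom (C i) D) :
  jointly_epic h -> jointly_epic (fun i => cprod (h i) (cidm Z)).
Proof.
move=> hepi W f g fg; apply: (@tlift_uniq K D Z W f g) => d z.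
have lin (k : {linear tensor D Z -> W}) : linear (fun d => k (d *t z)).
  by move=> a b c; rewrite tensDl tensZl linearP.
have [f' f'E] := linear_build (lin f); have [g' g'E] := linear_build (lin g).
rewrite -[LHS]f'E -[RHS]g'E; apply: hepi => i c; rewrite f'E g'E.
by have := fg i (c *t z); rewrite cprodE.
Qed.

Lemma jointly_epic_eq D D' C (h : forall i, coalgHom (C i) D) (f g : coalgHom D D') :
  jointly_epic h -> (forall i, f \@ h i = g \@ h i) -> f = g.
Proof.
move=> hepi fg; apply: coalgHom_eq; apply: hepi => i c.
exact: (congr1 (fun k : coalgHom _ _ => k c) (fg i)).
Qed.

End JointlyEpic.

(** * The universal coalgebra of automorphisms *)

Section AutomorphismObject.
Variables (K : fieldType) (X : cocHopf K).
Implicit Types T C : coalg K.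
Local Notation X' := (coalg_of X).

(** [F] is seen as a family of operations on [X] parametrised by [T], here evaluated at a parameter
    [u] and a point [x]. *)
Definition app T T' (F : coalgHom (tcoalg T X') X') (u : coalgHom T' T)
  (x : pts T' X) : pts T' X := F \@ cpair u x.

Lemma app_comp T T' T'' F (u : coalgHom T' T) (x : pts T' X) (w : coalgHom T'' T') :
  ptcomp (app F u x) w = app F (u \@ w) (ptcomp x w).
Proof. by rewrite /app /ptcomp -[LHS]ccompA pair_comp. Qed.

Lemma app_cprod T T' T'' F (r : coalgHom T' T) (u : coalgHom T'' T') (x : pts T'' X) :
  app (F \@ cprod r (cidm X')) u x = app F (r \@ u) x.
Proof. by rewrite /app -ccompA cprod_pair ccomp1m. Qed.

(* A [T]-point of the automorphism group of [X]: [F] and [G] are mutually inverse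
   automorphisms of [X], parametrised by [T]. *)
Definition aut T (F G : coalgHom (tcoalg T X') X') :=
  [/\ forall T' (u : coalgHom T' T) (x y : pts T' X),
        app F u (x * y)%g = (app F u x * app F u y)%g,
      forall T' (u : coalgHom T' T) (x : pts T' X), app F u (app G u x) = x &
      forall T' (u : coalgHom T' T) (x : pts T' X), app G u (app F u x) = x].

Lemma aut_sym T F G : @aut T F G -> aut G F.
Proof.
move=> [FM FG GF]; split=> // T' u x y.
by rewrite -{1}[x](FG _ u) -{1}[y](FG _ u) -FM GF.
Qed.

Lemma eq_app T F F' :
  (forall T' (u : coalgHom T' T) (x : pts T' X), app F u x = app F' u x) -> F = F'.
Proof.
move=> /(_ _ (pr1 T X') (pr2 T X')); rewrite /app.
by rewrite (_ : cpair _ _ = cidm _) ?ccompm1 // [RHS]pair_eta !ccompm1.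
Qed.

Lemma aut_inv_uniq T F G G' : @aut T F G -> aut F G' -> G = G'.
Proof.
move=> [_ FG GF] [_ FG' _]; apply: eq_app => T' u x.
by rewrite -{1}[x](FG' _ u) GF.
Qed.

(** All functions are allowed, so that the module structure is pointwise; linearity is recovered in
    [measuring_ex]. The second component is meant for the inverse. *)
Definition endo2 : lmodType K := ((X -> X) * (X -> X))%type.

Definition aut_measuring C (f : {linear C -> endo2}) :=
  exists F G, aut F G /\
    forall c x, F (c *t x) = (f c).1 x /\ G (c *t x) = (f c).2 x.

Section Terminal.
Variables (R : coalg K) (iota : {linear R -> endo2}).
Hypothesis span : forall (W : lmodType K) (h1 h2 : {linear R -> W}),
  (forall C (h : coalgHom C R), aut_measuring (iota \o h) ->
    forall c, h1 (h c) = h2 (h c)) -> h1 =1 h2.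

Lemma span_eq (W : lmodType K) (h1 h2 : R -> W) : linear h1 -> linear h2 ->
  (forall C (h : coalgHom C R), aut_measuring (iota \o h) ->
    forall c, h1 (h c) = h2 (h c)) -> h1 =1 h2.
Proof.
move=> /linear_build[g1 e1] /linear_build[g2 e2] h12 r; rewrite -e1 -e2.
by apply: span => C h gh c; rewrite e1 e2; apply: h12.
Qed.

(** For fixed arguments in [X], linearity of [k r] and compatibility with coproduct and counit are
    equations between linear maps in [r]. So they may be checked on the elements [h c], where they
    hold for a given coalgebra morphism. *)
Lemma measuring_ex (k : {linear R -> (X -> X : lmodType K)}) :
  (forall C (h : coalgHom C R), aut_measuring (iota \o h) ->
    exists F : coalgHom (tcoalg C X') X', forall c x, F (c *t x) = k (h c) x) ->
  exists F : coalgHom (tcoalg R X') X', forall r x, F (r *t x) = k r x.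
Proof.
move=> kP.
have kx x : linear (fun r => k r x) by move=> a r s; rewrite linearP.
have kr r : linear (k r).
  move=> a x y; apply: (span_eq (h1 := fun r => k r (a *: x + y))
    (h2 := fun r => a *: k r x + k r y)) r => [b r s|b r s|C h gh c].
  - by rewrite kx.
  - by rewrite !kx !scalerDr !scalerA addrACA mulrC.
  - have [F FE] := kP C h gh.
    by rewrite -!FE tensDr tensZr linearP.
have kb : bilin (fun (r : R) (x : X') => k r x : X') by split.
pose F : {linear tcoalg R X' -> X'} := tlin kb.
have FE r x : F (r *t x) = k r x by exact: tliftE.
have Fh C (h : coalgHom C R) (F' : coalgHom (tcoalg C X') X') :
    (forall c x, F' (c *t x) = k (h c) x) ->
    F \o cprod h (cidm X') =1 F' :> (tcoalg C X' -> X').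
  move=> F'E; pose g : {linear tensor C X' -> X'} := F \o cprod h (cidm X').
  apply: (@tlift_uniq K C X' X' g F') => c x.
  by rewrite F'E -FE; congr (F _); apply: cprodE.
have Fm y : cmul X' (F y) = tmap F F (cmul (tcoalg R X') y).
  elim/tens_ind: y => [r x|y z IHy IHz]; last by rewrite !linearD IHy IHz.
  apply: (span_eq (h1 := fun r => cmul X' (F (r *t x)))
     (h2 := fun r => tmap F F (cmul (tcoalg R X') (r *t x)))) r => [a r s|a r s|C h gh c].
  - by rewrite tensDl tensZl !linearP.
  - by rewrite tensDl tensZl !linearP.
  - have [F' F'E] := kP C h gh.
    rewrite FE -F'E chom_mul.
    transitivity (tmap F F (cmul (tcoalg R X') (cprod h (cidm X') (c *t x)))); last first.
      by rewrite cprodE.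
    rewrite chom_mul tmap_comp; apply: eq_tmap => z; exact: esym (Fh _ _ _ F'E z).
have F1 y : cone X' (F y) = cone (tcoalg R X') y.
  elim/tens_ind: y => [r x|y z IHy IHz]; last by rewrite !linearD IHy IHz.
  apply: (span_eq (W := K^o) (h1 := fun r => cone X' (F (r *t x)))
     (h2 := fun r => cone (tcoalg R X') (r *t x))) r => [a r s|a r s|C h gh c].
  - by rewrite tensDl tensZl !linearP.
  - by rewrite tensDl tensZl !linearP.
  - have [F' F'E] := kP C h gh.
    by rewrite FE -F'E chom_one [LHS]tconeE [RHS]tconeE chom_one.
by exists (CoalgHom Fm F1).
Qed.

(** Shows that [iota] itself is an automorphism measuring, hence universal. The equations defining
    [aut] hold after restriction along each member of a jointly epic family, and tensoring with [X']
    keeps it jointly epic. *)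
Lemma measuring_aut : exists F G, @aut R F G /\
  forall r x, F (r *t x) = (iota r).1 x /\ G (r *t x) = (iota r).2 x.
Proof.
have [k1 k1E] : exists k : {linear R -> (X -> X : lmodType K)},
    forall r, k r = (iota r).1.
  by apply: linear_build => a r s; rewrite linearP.
have [k2 k2E] : exists k : {linear R -> (X -> X : lmodType K)},
    forall r, k r = (iota r).2.
  by apply: linear_build => a r s; rewrite linearP.
have [|F FE] := measuring_ex (k := k1).
  move=> C h [F [G [_ FGE]]]; exists F => c x.
  by rewrite k1E; have [] := FGE c x.
have [|G GE] := measuring_ex (k := k2).
  move=> C h [F' [G [_ FGE]]]; exists G => c x.
  by rewrite k2E; have [] := FGE c x.
exists F, G; split; last by move=> r x; rewrite FE GE k1E k2E.
have restr C (h : coalgHom C R) : aut_measuring (iota \o h) ->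
    aut (F \@ cprod h (cidm X')) (G \@ cprod h (cidm X')).
  move=> [F' [G' [FG' FGE]]].
  have -> : F \@ cprod h (cidm X') = F'.
    apply: coalgHom_eq; apply: (@tlift_uniq K C X' X' (F \@ cprod h (cidm X')) F').
    move=> c x; have [-> _] := FGE c x.
    by rewrite -k1E -FE; congr (F _); apply: cprodE.
  have -> : G \@ cprod h (cidm X') = G'.
    apply: coalgHom_eq; apply: (@tlift_uniq K C X' X' (G \@ cprod h (cidm X')) G').
    move=> c x; have [_ ->] := FGE c x.
    by rewrite -k2E -GE; congr (G _); apply: cprodE.
  by [].
pose I := {C : coalg K & {h : coalgHom C R | aut_measuring (iota \o h)}}.
pose h (i : I) : coalgHom (projT1 i) R := sval (projT2 i).
have gh (i : I) : aut (F \@ cprod (h i) (cidm X')) (G \@ cprod (h i) (cidm X')) :=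
  restr _ _ (svalP (projT2 i)).
have epi1 : jointly_epic h.
  by move=> W f g fg; apply: span => C k gk c; exact: (fg (existT _ C (exist _ k gk)) c).
have epi2 := jointly_epic_tensor (Z := X') epi1.
have epi3 := jointly_epic_tensor (Z := X') epi2.
(* Generic points: multiplicativity involves two points of [X], hence two tensorings, and mutual
   inverseness only one. Arbitrary points are handled at the end by composition. *)
pose x1 : pts (tcoalg R X') X := pr2 R X'.
pose q := pr1 (tcoalg R X') X'; pose y : pts _ X := pr2 (tcoalg R X') X'.
pose r := pr1 R X' \@ q; pose x : pts _ X := ptcomp x1 q.
have FM : app F r (x * y)%g = (app F r x * app F r y)%g.
  apply: (jointly_epic_eq epi3) => i.
  set w := cprod _ _; pose r' := pr1 (projT1 i) X' \@ pr1 _ X'.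
  have rw : r \@ w = h i \@ r'.
    by rewrite /r /w -ccompA /cprod pr1_pair !ccompA pr1_pair.
  rewrite -!/(ptcomp _ w) app_comp !ptcompM !app_comp rw -!(app_cprod _ (h i)).
  by case: (gh i) => -> _ _.
have FG : app F (pr1 R X') (app G (pr1 R X') x1) = x1.
  apply: (jointly_epic_eq epi2) => i.
  set w := cprod _ _; have rw : pr1 R X' \@ w = h i \@ pr1 _ X' by exact: pr1_pair.
  rewrite -!/(ptcomp _ w) !app_comp rw -!(app_cprod _ (h i)).
  by case: (gh i) => _ -> _.
have GF : app G (pr1 R X') (app F (pr1 R X') x1) = x1.
  apply: (jointly_epic_eq epi2) => i.
  set w := cprod _ _; have rw : pr1 R X' \@ w = h i \@ pr1 _ X' by exact: pr1_pair.
  rewrite -!/(ptcomp _ w) !app_comp rw -!(app_cprod _ (h i)).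
  by case: (gh i) => _ _ ->.
split=> T u a.
- move=> b; pose w := cpair (cpair u a) b.
  have rw : r \@ w = u by rewrite /r /w -ccompA !pr1_pair.
  have xw : ptcomp x w = a by rewrite /ptcomp /x /ptcomp /w -ccompA pr1_pair pr2_pair.
  have yw : ptcomp y w = b by exact: pr2_pair.
  have := congr1 (fun p => ptcomp p w) FM.
  by rewrite app_comp !ptcompM !app_comp rw xw yw.
- have := congr1 (fun p => ptcomp p (cpair u a)) FG.
  by rewrite !app_comp [ptcomp x1 _]pr2_pair pr1_pair.
- have := congr1 (fun p => ptcomp p (cpair u a)) GF.
  by rewrite !app_comp [ptcomp x1 _]pr2_pair pr1_pair.
Qed.

End Terminal.

Theorem automorphism_coalg : exists (R : coalg K) (F G : coalgHom (tcoalg R X') X'),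
  [/\ aut F G,
      forall T (F' G' : coalgHom (tcoalg T X') X'), aut F' G' ->
        exists r : coalgHom T R, forall T' (u : coalgHom T' T) (x : pts T' X),
          app F (r \@ u) x = app F' u x &
      forall T (r r' : coalgHom T R),
        (forall T' (u : coalgHom T' T) (x : pts T' X),
          app F (r \@ u) x = app F (r' \@ u) x) -> r = r'].
Proof.
have [R [iota [univ uniq span]]] := cofree_coalg aut_measuring.
have [F [G [FG FGE]]] := measuring_aut span.
exists R, F, G; split=> // [T F' G' FG'|T r r' rr'].
  have [f fE] : exists f : {linear T -> endo2},
      forall c, f c = (fun x => F' (c *t x), fun x => G' (c *t x)).
    apply: linear_build => a c d; congr pair; apply: funext => x;
      by rewrite tensDl tensZl linearP.
  have gf : aut_measuring f by exists F', G'; split=> // c x; rewrite fE.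
  have [r rE] := univ _ _ gf; exists r => T' u x.
  rewrite -app_cprod; congr (app _ _ _); apply: coalgHom_eq.
  apply: (@tlift_uniq K T X' X' (F \@ cprod r (cidm X')) F') => c z.
  transitivity (F (r c *t z)); first by congr (F _); apply: cprodE.
  by have [-> _] := FGE (r c) z; rewrite rE fE.
have eF : F \@ cprod r (cidm X') = F \@ cprod r' (cidm X').
  by apply: eq_app => T' u x; rewrite !app_cprod.
have autr (s : coalgHom T R) : aut (F \@ cprod s (cidm X')) (G \@ cprod s (cidm X')).
  by case: FG => FM FGK GFK; split=> T' u x *; rewrite !app_cprod ?FM ?FGK ?GFK.
(* Faithfulness concerns [F] alone, while [iota] has two components; uniqueness of inverses supplies
   the other. *)
have eG : G \@ cprod r (cidm X') = G \@ cprod r' (cidm X').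
  by apply: aut_inv_uniq (autr r) _; rewrite eF; apply: autr.
apply: uniq => c; rewrite [LHS]surjective_pairing [RHS]surjective_pairing.
congr pair; apply: funext => x.
  have [<- _] := FGE (r c) x; have [<- _] := FGE (r' c) x.
  by have := congr1 (fun k : coalgHom (tcoalg T X') X' => k (c *t x)) eF;
    rewrite /= !cprodE.
have [_ <-] := FGE (r c) x; have [_ <-] := FGE (r' c) x.
by have := congr1 (fun k : coalgHom (tcoalg T X') X' => k (c *t x)) eG;
  rewrite /= !cprodE.
Qed.

End AutomorphismObject.

(** * The automorphism group as a Hopf algebra *)

Section AutomorphismGroup.
Variables (K : fieldType) (X : cocHopf K).
Implicit Types T : coalg K.
Local Notation X' := (coalg_of X).

Lemma app_ptcomp T T' (E : pts (tcoalg T X') X) (u : coalgHom T' T) (x : pts T' X) :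
  app E u x = ptcomp E (cpair u x).
Proof. by []. Qed.

(** Composition, identity and inversion of parametrised automorphisms define operations on points by
    universality, and faithfulness turns each group law and each naturality condition into an
    identity between actions. The Hopf algebra comes with an isomorphism of coalgebras onto the
    universal one, along which the action is transported. *)
Theorem automorphism_hopf :
  exists (R : cocHopf K) (F : coalgHom (tcoalg (coalg_of R) X') X'),
  [/\ forall T (r : pts T R) (x y : pts T X),
        app F r (x * y)%g = (app F r x * app F r y)%g,
      forall T (r r' : pts T R) (x : pts T X),
        app F (r * r')%g x = app F r (app F r' x),
      forall T (F' G' : coalgHom (tcoalg T X') X'), aut F' G' ->
        exists r : pts T R, forall T' (u : coalgHom T' T) (x : pts T' X),
          app F (ptcomp r u) x = app F' u x &
      forall T (r r' : pts T R),
        (forall T' (u : coalgHom T' T) (x : pts T' X),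
          app F (ptcomp r u) x = app F (ptcomp r' u) x) -> r = r'].
Proof.
have [R [F [G [[FM FG GF] univ faith]]]] := automorphism_coalg X.
have GM : forall T (u : coalgHom T R) (x y : pts T X),
    app G u (x * y)%g = (app G u x * app G u y)%g.
  by case: (aut_sym (And3 FM FG GF)).
have ex_mul T (r r' : coalgHom T R) : exists s : coalgHom T R,
    forall T' (u : coalgHom T' T) (x : pts T' X),
      app F (s \@ u) x = app F (r \@ u) (app F (r' \@ u) x).
  pose p := pr1 T X'; pose x0 : pts _ X := pr2 T X'.
  pose F' := app F (r \@ p) (app F (r' \@ p) x0).
  pose G' := app G (r' \@ p) (app G (r \@ p) x0).
  have F'E T' (u : coalgHom T' T) x : app F' u x = app F (r \@ u) (app F (r' \@ u) x).
    by rewrite app_ptcomp !app_comp -!ccompA pr1_pair [ptcomp _ _]pr2_pair.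
  have G'E T' (u : coalgHom T' T) x : app G' u x = app G (r' \@ u) (app G (r \@ u) x).
    by rewrite app_ptcomp !app_comp -!ccompA pr1_pair [ptcomp _ _]pr2_pair.
  have [|s sE] := univ T F' G'; last by exists s => T' u x; rewrite sE F'E.
  by split=> T' u x *; rewrite !(F'E, G'E) ?FM ?FG ?GF.
have ex_one T : exists s : coalgHom T R,
    forall T' (u : coalgHom T' T) (x : pts T' X), app F (s \@ u) x = x.
  have E T' (u : coalgHom T' T) x : app (pr2 T X') u x = x by exact: pr2_pair.
  have [|s sE] := univ T (pr2 T X') (pr2 T X'); last by exists s => T' u x; rewrite sE.
  by split=> *; rewrite !E.
have ex_inv T (r : coalgHom T R) : exists s : coalgHom T R,
    forall T' (u : coalgHom T' T) (x : pts T' X), app F (s \@ u) x = app G (r \@ u) x.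
  have [|s sE] := univ T (G \@ cprod r (cidm X')) (F \@ cprod r (cidm X')).
    by split=> T' u x *; rewrite !app_cprod ?GM ?FG ?GF.
  by exists s => T' u x; rewrite sE app_cprod.
pose mul T r r' := sval (cid (ex_mul T r r')).
pose one T := sval (cid (ex_one T)).
pose inv T r := sval (cid (ex_inv T r)).
have mulE T r r' T' (u : coalgHom T' T) x :
    app F (mul T r r' \@ u) x = app F (r \@ u) (app F (r' \@ u) x).
  exact: (svalP (cid (ex_mul T r r'))).
have oneE T T' (u : coalgHom T' T) x : app F (one T \@ u) x = x.
  exact: (svalP (cid (ex_one T))).
have invE T r T' (u : coalgHom T' T) x : app F (inv T r \@ u) x = app G (r \@ u) x.
  exact: (svalP (cid (ex_inv T r))).
have mulA T : associative (mul T) by move=> a b c; apply: faith => *; rewrite !mulE.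
have mul1 T : left_id (one T) (mul T).
  by move=> a; apply: faith => *; rewrite !mulE oneE.
have mulr1 T : right_id (one T) (mul T).
  by move=> a; apply: faith => *; rewrite !mulE oneE.
have mulV T : left_inverse (one T) (inv T) (mul T).
  by move=> a; apply: faith => *; rewrite !mulE invE oneE GF.
have mulrV T : right_inverse (one T) (inv T) (mul T).
  by move=> a; apply: faith => *; rewrite !mulE invE oneE FG.
have mul_nat T T' a b (w : coalgHom T' T) : mul T a b \@ w = mul T' (a \@ w) (b \@ w).
  by apply: faith => T'' u x; rewrite -ccompA !mulE !ccompA.
have one_nat T T' (w : coalgHom T' T) : one T \@ w = one T'.
  by apply: faith => T'' u x; rewrite -ccompA !oneE.
have [H [f [g [fg gf fM]]]] :=
  hopf_of_functor mulA mul1 mulr1 mulV mulrV mul_nat one_nat.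
exists H, (F \@ cprod f (cidm X')); split.
- by move=> T r x y; rewrite !app_cprod FM.
- move=> T r r' x; rewrite !app_cprod fM.
  by rewrite -[mul _ _ _]ccompm1 mulE !ccompm1.
- move=> T F' G' FG'; have [r rE] := univ _ _ _ FG'; exists (g \@ r) => T' u x.
  by rewrite app_cprod /ptcomp !ccompA fg ccomp1m rE.
- move=> T r r' rr'; rewrite -[r]ccomp1m -[r']ccomp1m -gf -!ccompA; congr (_ \@ _).
  by apply: faith => T' u x; have := rr' T' u x; rewrite !app_cprod /ptcomp !ccompA.
Qed.

End AutomorphismGroup.

(** * Split extensions *)

Section SplitExtensions.
Variable K : fieldType.
Implicit Types (A B X Z : cocHopf K) (T : coalg K).
Local Open Scope group_scope.

Lemma ptmap_inj A B (f g : bialgHom A B) :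
  (forall T (a : pts T A), ptmap f a = ptmap g a) -> f = g.
Proof.
move=> /(_ _ (cidm (coalg_of A))) fg; apply: bialgHom_eq => a.
exact: (congr1 (fun h : coalgHom (coalg_of A) (coalg_of B) => h a) fg).
Qed.

Lemma bialg_of_points A B (f : coalgHom (coalg_of A) (coalg_of B)) :
  (forall T (a b : pts T A), f \@ (a * b) = (f \@ a : pts T B) * (f \@ b)) ->
  exists h : bialgHom A B, forall T (a : pts T A), ptmap h a = f \@ a.
Proof. by move=> /bialg_of_coalg[h hf]; exists h => T a; rewrite /ptmap hf. Qed.

Definition bzero A B : bialgHom A B := bialg_comp (of_unit B) (to_unit A).

Lemma ptmap_zero A B T (a : pts T A) : ptmap (bzero A B) a = 1.
Proof.
by apply: coalgHom_eq => t; rewrite [RHS]ptoneE -(chom_one a).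
Qed.

(** [is_kernel] for [Hopf_coc], unfolded so that arguments on points apply directly. *)
Definition bialg_kernel X A B (k : bialgHom X A) (p : bialgHom A B) :=
  bialg_comp p k = bzero X B /\
  forall Z (h : bialgHom Z A), bialg_comp p h = bzero Z B ->
    exists! u : bialgHom Z X, bialg_comp k u = h.

Section Kernel.
Variables (X A B : cocHopf K) (k : bialgHom X A) (p : bialgHom A B)
  (s : bialgHom B A).
Hypothesis ps : bialg_comp p s = bialg_id B.
Hypothesis kerP : bialg_kernel k p.

Let psT T (b : pts T B) : ptmap p (ptmap s b) = b.
Proof. by rewrite -ptmap_comp ps ptmap_id. Qed.

Let pkT T (x : pts T X) : ptmap p (ptmap k x) = 1.
Proof. by rewrite -ptmap_comp kerP.1 ptmap_zero. Qed.

Let pi : pts (coalg_of A) A :=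
  let a : pts (coalg_of A) A := cidm (coalg_of A) in a * (ptmap s (ptmap p a))^-1.

Let piE T (a : pts T A) : pi \@ a = a * (ptmap s (ptmap p a))^-1.
Proof.
rewrite -/(ptcomp pi a) ptcompM ptcompV !ptmap_ptcomp.
by rewrite (_ : ptcomp _ a = a) //; apply: ccomp1m.
Qed.

Let ppi T (a : pts T A) : ptmap p (pi \@ a) = 1.
Proof. by rewrite piE ptmapM ptmapV psT mulgV. Qed.

Let pi_id T (a : pts T A) : ptmap p a = 1 -> pi \@ a = a.
Proof. by move=> pa; rewrite piE pa ptmap1 invg1 mulg1. Qed.

(** [pi] is an idempotent coalgebra endomorphism of [A]; it is split through its fixed subspace. *)
Lemma pi_split : exists (D : coalg K) (j : coalgHom D (coalg_of A))
  (q : coalgHom (coalg_of A) D), q \@ j = cidm D /\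
    forall T (a : pts T A), j \@ (q \@ a) = a * (ptmap s (ptmap p a))^-1.
Proof.
have pipi : pi \@ pi = pi by apply: pi_id; rewrite -[pi]ccompm1 ppi.
have pipiE a : pi (pi a) = pi a.
  exact: (congr1 (fun h : coalgHom (coalg_of A) (coalg_of A) => h a) pipi).
have [L [i [i_inj iP Pi]]] := @submoduleP K A (fun a => pi a = a) (linear0 _)
  (fun a x y px py => etrans (linearP _ a x y) (congr2 (fun x y => a *: x + y)%R px py)).
have [r rE] : exists r : {linear A -> L}, forall a, i (r a) = pi a.
  pose r a := sval (cid (Pi _ (pipiE a))).
  have rE a : i (r a) = pi a := svalP (cid (Pi _ (pipiE a))).
  have rl : linear r by move=> a x y; apply: i_inj; rewrite linearP !rE linearP.
  by have [q qE] := linear_build rl; exists q => a; rewrite qE rE.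
have ir : cancel i r by move=> x; apply: i_inj; rewrite rE iP.
have [||d [e [[dA d1 dC] id rd ie re]]] := @retract_coalg K (coalg_of A) L i r ir.
- move=> x; rewrite rE chom_mul; apply: eq_tmap => y; exact: esym (rE y).
- by move=> x; rewrite rE chom_one.
pose D := Coalg dA d1 dC.
exists D, (@CoalgHom K D (coalg_of A) i id ie), (@CoalgHom K (coalg_of A) D r rd re).
split=> [|T a]; first by apply: coalgHom_eq => x; rewrite /= ir.
by rewrite -piE; apply: coalgHom_eq => x; rewrite /= rE.
Qed.

(** The image [D] of [pi] is the kernel of [p] on points over coalgebras, and so inherits a group
    structure making it a Hopf algebra [H]. Its inclusion [i] into [A] is killed by [p], hence
    factors as [k] after some [u]; conversely [k] factors as [i] after some [v], and uniqueness for
    the kernel gives u v = 1. The retraction is [pi] followed by [u]. *)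
Lemma kernel_retraction : exists th : coalgHom (coalg_of A) (coalg_of X),
  (forall T (a : pts T A), ptmap k (th \@ a) = a * (ptmap s (ptmap p a))^-1) /\
  (forall T (x : pts T X), th \@ ptmap k x = x).
Proof.
have [D [j [q [qj jqE]]]] := pi_split.
have j_inj T (a b : coalgHom T D) : j \@ a = j \@ b -> a = b.
  by move=> ab; rewrite -[a]ccomp1m -[b]ccomp1m -qj -!ccompA ab.
have jq T (a : pts T A) : ptmap p a = 1 -> j \@ (q \@ a) = a.
  by move=> pa; rewrite jqE pa ptmap1 invg1 mulg1.
have pj T (a : coalgHom T D) : ptmap p (j \@ a) = 1.
  rewrite -[a]ccomp1m -qj -ccompA jqE ptmapM ptmapV.
  by rewrite psT mulgV.
pose mul T (a b : coalgHom T D) : coalgHom T D :=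
  q \@ ((j \@ a : pts T A) * (j \@ b)).
pose one T : coalgHom T D := q \@ (1 : pts T A).
pose inv T (a : coalgHom T D) : coalgHom T D := q \@ (j \@ a : pts T A)^-1.
have mulE T a b : j \@ mul T a b = (j \@ a : pts T A) * (j \@ b).
  by apply: jq; rewrite ptmapM !pj mulg1.
have oneE T : j \@ one T = (1 : pts T A) by apply: jq; rewrite ptmap1.
have invE T a : j \@ inv T a = (j \@ a : pts T A)^-1.
  by apply: jq; rewrite ptmapV pj invg1.
have mulA T : associative (mul T) by move=> a b c; apply: j_inj; rewrite !mulE mulgA.
have mul1 T : left_id (one T) (mul T).
  by move=> a; apply: j_inj; rewrite mulE oneE mul1g.
have mulr1 T : right_id (one T) (mul T).
  by move=> a; apply: j_inj; rewrite mulE oneE mulg1.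
have mulV T : left_inverse (one T) (inv T) (mul T).
  by move=> a; apply: j_inj; rewrite mulE oneE invE mulVg.
have mulrV T : right_inverse (one T) (inv T) (mul T).
  by move=> a; apply: j_inj; rewrite mulE oneE invE mulgV.
have mul_nat T T' a b (w : coalgHom T' T) : mul T a b \@ w = mul T' (a \@ w) (b \@ w).
  by apply: j_inj; rewrite ccompA !mulE -/(ptcomp _ w) ptcompM /ptcomp -!ccompA.
have one_nat T T' (w : coalgHom T' T) : one T \@ w = one T'.
  by apply: j_inj; rewrite ccompA !oneE -/(ptcomp _ w) ptcomp1.
have [H [f [g [fg gf fM]]]] :=
  hopf_of_functor mulA mul1 mulr1 mulV mulrV mul_nat one_nat.
have [|i iE] := @bialg_of_points H A (j \@ f).
  by move=> T a b; rewrite -ccompA fM mulE !ccompA.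
have i_inj T (a b : pts T H) : ptmap i a = ptmap i b -> a = b.
  rewrite !iE -!ccompA => /j_inj fab.
  by rewrite -[a]ccomp1m -[b]ccomp1m -gf -!ccompA fab.
have pi0 : bialg_comp p i = bzero H B.
  by apply: ptmap_inj => T a; rewrite ptmap_comp iE -ccompA pj ptmap_zero.
have [u [ku _]] := kerP.2 _ _ pi0.
have ig T (a : pts T A) : ptmap i (g \@ (q \@ a)) = j \@ (q \@ a).
  by rewrite iE !ccompA -[j \@ f \@ g]ccompA fg ccompm1.
have igk T (x : pts T X) : ptmap i (g \@ (q \@ ptmap k x)) = ptmap k x.
  by rewrite ig jq ?pkT.
have [|v vE] := @bialg_of_points X H (g \@ (q \@ coalg_hom k)).
  by move=> T a b; apply: i_inj; rewrite -!ccompA ptmapM !igk ptmapM.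
have iv : bialg_comp i v = k.
  by apply: ptmap_inj => T a; rewrite ptmap_comp vE -!ccompA igk.
have uv : bialg_comp u v = bialg_id X.
  have [w [_ wU]] := kerP.2 _ _ kerP.1.
  transitivity w; last by apply: wU; apply: ptmap_inj => T a; rewrite ptmap_comp ptmap_id.
  apply/esym/wU; apply: ptmap_inj => T a.
  by rewrite !ptmap_comp -(ptmap_comp k u) ku -ptmap_comp iv.
exists (coalg_hom u \@ (g \@ q)); split=> T a.
  by rewrite -!ccompA -[coalg_hom u \@ _]/(ptmap u _) -ptmap_comp ku ig jqE.
transitivity (ptmap u (ptmap v a)); first by rewrite vE -!ccompA.
by rewrite -ptmap_comp uv ptmap_id.
Qed.

End Kernel.

End SplitExtensions.

(** * Split extensions and actions *)

Section Representation.
Variables (K : fieldType) (X R : cocHopf K).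
Implicit Types (A B Z : cocHopf K) (T : coalg K).
Local Open Scope group_scope.
Local Notation X' := (coalg_of X).
Variable F : coalgHom (tcoalg (coalg_of R) X') X'.
Hypothesis actMr : forall T (r : pts T R) (x y : pts T X),
  app F r (x * y) = app F r x * app F r y.
Hypothesis actMl : forall T (r r' : pts T R) (x : pts T X),
  app F (r * r') x = app F r (app F r' x).
Hypothesis act_univ : forall T (F' G' : coalgHom (tcoalg T X') X'), aut F' G' ->
  exists r : pts T R, forall T' (u : coalgHom T' T) (x : pts T' X),
    app F (ptcomp r u) x = app F' u x.
Hypothesis act_faithful : forall T (r r' : pts T R),
  (forall T' (u : coalgHom T' T) (x : pts T' X),
    app F (ptcomp r u) x = app F (ptcomp r' u) x) -> r = r'.

(** By universality some point acts trivially; by faithfulness it is idempotent in a group, hence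
    neutral. *)
Lemma act_one T (x : pts T X) : app F (1 : pts T R) x = x.
Proof.
have e T' (u : coalgHom T' T) (y : pts T' X) : app (pr2 T X') u y = y by exact: pr2_pair.
have [|r rE] := @act_univ T (pr2 T X') (pr2 T X'); first by split=> *; rewrite !e.
have r1 : r = 1.
  apply: (mulgI r); rewrite mulg1; apply: act_faithful => T' u y.
  by rewrite ptcompM actMl !rE !e.
by have := rE _ (cidm T) x; rewrite e r1 ptcomp1.
Qed.

Lemma act_one_r T (r : pts T R) : app F r (1 : pts T X) = 1.
Proof. by apply: (mulgI (app F r 1)); rewrite -actMr !mulg1. Qed.

(** On points [A] is X times B, with coordinates [th] and [p]. The former is only a coalgebra
    morphism: it need not be multiplicative. *)
Definition split_data A B (k : bialgHom X A) (p : bialgHom A B) (s : bialgHom B A)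
    (th : coalgHom (coalg_of A) X') : Prop :=
  [/\ forall T (a : pts T A), ptmap k (th \@ a) * ptmap s (ptmap p a) = a,
      forall T (x : pts T X) (b : pts T B), th \@ (ptmap k x * ptmap s b) = x,
      forall T (x : pts T X), ptmap p (ptmap k x) = 1 &
      forall T (b : pts T B), ptmap p (ptmap s b) = b].

(* Inside [A], conjugation by [s b] restricts on [X] to the action of [h b]. *)
Definition conj_action A B (k : bialgHom X A) (s : bialgHom B A) (h : bialgHom B R) :=
  forall T (b : pts T B) (x : pts T X),
    ptmap s b * ptmap k x = ptmap k (app F (ptmap h b) x) * ptmap s b.

Lemma split_dataP A B (k : bialgHom X A) (p : bialgHom A B) (s : bialgHom B A) :
  bialg_comp p s = bialg_id B -> bialg_kernel k p -> exists th, split_data k p s th.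
Proof.
move=> ps kerP; have [th [kth thk]] := kernel_retraction ps kerP.
have pk T (x : pts T X) : ptmap p (ptmap k x) = 1.
  by rewrite -ptmap_comp kerP.1 ptmap_zero.
have psE T (b : pts T B) : ptmap p (ptmap s b) = b.
  by rewrite -ptmap_comp ps ptmap_id.
exists th; split=> // T a.
  by rewrite kth mulgVK.
move=> b; rewrite -[LHS]thk kth ptmapM pk mul1g psE mulgK; exact: thk.
Qed.

Section OneExtension.
Variables (A B : cocHopf K) (k : bialgHom X A) (p : bialgHom A B)
  (s : bialgHom B A) (th : coalgHom (coalg_of A) X').
Hypothesis dat : split_data k p s th.

Lemma split_k_inj T (x y : pts T X) : ptmap k x = ptmap k y -> x = y.
Proof.
by case: dat => _ thE _ _ e; rewrite -(thE _ x 1) -(thE _ y 1) e.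
Qed.

Lemma split_th_ker T (a : pts T A) : ptmap p a = 1 -> ptmap k (th \@ a) = a.
Proof.
by case: dat => d1 _ _ _ pa; rewrite -[RHS]d1 pa ptmap1 mulg1.
Qed.

(** Conjugation by s b is formed at the generic point over B tensor X and brought back into [X] by
    [th], since it lies in the kernel of [p]; conjugation by the inverse is its inverse.
    Universality gives a coalgebra morphism from B to R, which is multiplicative by faithfulness. *)
Lemma conj_action_ex : exists h, conj_action k s h.
Proof.
case: (dat) => _ _ pk ps.
pose b0 : pts (tcoalg (coalg_of B) X') B := pr1 (coalg_of B) X'.
pose x0 : pts (tcoalg (coalg_of B) X') X := pr2 (coalg_of B) X'.
pose f : coalgHom (tcoalg (coalg_of B) X') X' :=
  th \@ (ptmap s b0 * ptmap k x0 * (ptmap s b0)^-1).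
pose g : coalgHom (tcoalg (coalg_of B) X') X' :=
  th \@ ((ptmap s b0)^-1 * ptmap k x0 * ptmap s b0).
have b0E T (b : pts T B) (x : pts T X) : ptcomp b0 (cpair b x) = b by exact: pr1_pair.
have x0E T (b : pts T B) (x : pts T X) : ptcomp x0 (cpair b x) = x by exact: pr2_pair.
have fE T (b : pts T B) (x : pts T X) :
    ptmap k (app f b x) = ptmap s b * ptmap k x * (ptmap s b)^-1.
  rewrite /app -ccompA -/(ptcomp _ (cpair b x)) !(ptcompM, ptcompV) !ptmap_ptcomp b0E x0E.
  by apply: split_th_ker; rewrite !(ptmapM, ptmapV) pk ps mulg1 mulgV.
have gE T (b : pts T B) (x : pts T X) :
    ptmap k (app g b x) = (ptmap s b)^-1 * ptmap k x * ptmap s b.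
  rewrite /app -ccompA -/(ptcomp _ (cpair b x)) !(ptcompM, ptcompV) !ptmap_ptcomp b0E x0E.
  by apply: split_th_ker; rewrite !(ptmapM, ptmapV) pk ps mulg1 mulVg.
have fg : aut f g.
  split=> T b x.
  - move=> y; apply: split_k_inj; rewrite ptmapM !fE ptmapM !mulgA.
    by rewrite mulgVK.
  - by apply: split_k_inj; rewrite fE gE !mulgA mulgV mul1g mulgK.
  - by apply: split_k_inj; rewrite gE fE !mulgA mulVg mul1g mulgVK.
have [r rE] := act_univ fg.
have [|h hE] := @bialg_of_points K B R r.
  move=> T a b; apply: act_faithful => T' u x.
  have e (c : pts T B) : ptcomp (r \@ c : pts T R) u = ptcomp r (ptcomp c u).
    exact: coalgHom_eq.
  rewrite [in RHS]ptcompM actMl !e !rE ptcompM.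
  by apply: split_k_inj; rewrite !fE !ptmapM invgM !mulgA.
exists h => T b x.
have -> : app F (ptmap h b) x = app f b x by rewrite hE -(rE _ b x).
by rewrite fE mulgVK.
Qed.

Lemma conj_action_uniq h h' : conj_action k s h -> conj_action k s h' -> h = h'.
Proof.
move=> hh hh'; apply: ptmap_inj => T b; apply: act_faithful => T' u x.
rewrite !ptmap_ptcomp; apply: split_k_inj.
by apply: (mulIg (ptmap s (ptcomp b u))); rewrite -hh -hh'.
Qed.

End OneExtension.

Section TwoExtensions.
Variables (A B : cocHopf K) (k : bialgHom X A) (s : bialgHom B A).
Variables (A' B' : cocHopf K) (k' : bialgHom X A') (p' : bialgHom A' B')
  (s' : bialgHom B' A') (th' : coalgHom (coalg_of A') X').
Variables (f : bialgHom B' B) (h : bialgHom B R).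
Hypothesis dat' : split_data k' p' s' th'.
Hypothesis hh : conj_action k s h.
Hypothesis hh' : conj_action k' s' (bialg_comp h f).

(** The law of the semidirect product, obtained by moving s' past k' in (k' x)(s' b)(k' y)(s' c). *)
Lemma split_th_mul T (a b : pts T A') :
  th' \@ (a * b) = (th' \@ a : pts T X) *
    app F (ptmap (bialg_comp h f) (ptmap p' a)) (th' \@ b).
Proof.
case: (dat') => d1 d2 _ _; rewrite -{1}[a]d1 -{1}[b]d1.
rewrite mulgA -[_ * _ * ptmap k' _]mulgA hh' mulgA -ptmapM -mulgA -ptmapM.
exact: d2.
Qed.

(** The map (k' x)(s' b) |-> (k x)(s (f b)) is multiplicative because [B'] acts on [X] through
    [f]. *)
Lemma split_map : exists t : bialgHom A' A, forall T (a : pts T A'),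
  ptmap t a = ptmap k (th' \@ a) * ptmap s (ptmap f (ptmap p' a)).
Proof.
pose a0 : pts (coalg_of A') A' := cidm (coalg_of A').
pose t : pts (coalg_of A') A := ptmap k th' * ptmap s (ptmap f (ptmap p' a0)).
have tE T (a : pts T A') :
    t \@ a = ptmap k (th' \@ a) * ptmap s (ptmap f (ptmap p' a)).
  rewrite -/(ptcomp t a) ptcompM !ptmap_ptcomp.
  by rewrite [ptcomp a0 a]ccomp1m.
have [|t' t'E] := @bialg_of_points K A' A t; last first.
  by exists t' => T a; rewrite t'E tE.
move=> T a b; rewrite !tE split_th_mul !ptmapM ptmap_comp.
by rewrite !mulgA -[_ * _ * ptmap k (th' \@ b)]mulgA hh !mulgA.
Qed.

End TwoExtensions.

(** The semidirect product is defined on points of X tensor B; the resulting [A] is isomorphic to it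
    as a coalgebra, through [f] and [g], and everything is computed in coordinates. *)
Lemma semidirect B (h : bialgHom B R) :
  exists (A : cocHopf K) (k : bialgHom X A) (p : bialgHom A B) (s : bialgHom B A),
    [/\ bialg_comp p s = bialg_id B, bialg_kernel k p & conj_action k s h].
Proof.
pose C := tcoalg X' (coalg_of B).
pose fs T (a : coalgHom T C) : pts T X := pr1 _ _ \@ a.
pose sn T (a : coalgHom T C) : pts T B := pr2 _ _ \@ a.
have fsE T (x : pts T X) (b : pts T B) : fs T (cpair x b) = x by exact: pr1_pair.
have snE T (x : pts T X) (b : pts T B) : sn T (cpair x b) = b by exact: pr2_pair.
have ext T (a b : coalgHom T C) : fs T a = fs T b -> sn T a = sn T b -> a = b.
  exact: pair_inj.
pose mul T (a b : coalgHom T C) : coalgHom T C :=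
  cpair (fs T a * app F (ptmap h (sn T a)) (fs T b) : pts T X) (sn T a * sn T b : pts T B).
pose one T : coalgHom T C := cpair (1 : pts T X) (1 : pts T B).
pose inv T (a : coalgHom T C) : coalgHom T C :=
  cpair (app F (ptmap h (sn T a)^-1) (fs T a)^-1) ((sn T a)^-1 : pts T B).
have mulA T : associative (mul T).
  move=> a b c; apply: ext; rewrite !(fsE, snE) ?mulgA //.
  by rewrite actMr ptmapM actMl mulgA.
have mul1 T : left_id (one T) (mul T).
  by move=> a; apply: ext; rewrite !(fsE, snE) ?mul1g // ptmap1 act_one.
have mulr1 T : right_id (one T) (mul T).
  by move=> a; apply: ext; rewrite !(fsE, snE) ?mulg1 // act_one_r mulg1.
have mulV T : left_inverse (one T) (inv T) (mul T).
  move=> a; apply: ext; rewrite !(fsE, snE) ?mulVg //.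
  by rewrite -actMr mulVg act_one_r.
have mulrV T : right_inverse (one T) (inv T) (mul T).
  move=> a; apply: ext; rewrite !(fsE, snE) ?mulgV //.
  by rewrite -actMl -ptmapM mulgV ptmap1 act_one mulgV.
have mul_nat T T' a b (w : coalgHom T' T) : mul T a b \@ w = mul T' (a \@ w) (b \@ w).
  have fs_w c : fs T' (c \@ w) = ptcomp (fs T c) w by rewrite /fs ccompA.
  have sn_w c : sn T' (c \@ w) = ptcomp (sn T c) w by rewrite /sn ccompA.
  have app_w (r : pts T R) x : ptcomp (app F r x) w = app F (ptcomp r w) (ptcomp x w).
    exact: app_comp.
  apply: ext; rewrite !(fsE, snE, fs_w, sn_w) ptcompM //.
  by rewrite app_w ptmap_ptcomp.
have one_nat T T' (w : coalgHom T' T) : one T \@ w = one T'.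
  by rewrite /one pair_comp -!/(ptcomp _ w) !ptcomp1.
have [A [f [g [fg gf fM]]]] :=
  hopf_of_functor mulA mul1 mulr1 mulV mulrV mul_nat one_nat.
have fgE T (c : coalgHom T C) : f \@ (g \@ c) = c by rewrite ccompA fg ccomp1m.
have f_inj T (a b : pts T A) : f \@ a = f \@ b -> a = b.
  by move=> ab; rewrite -[a]ccomp1m -[b]ccomp1m -gf -!ccompA ab.
have [|p pE] := @bialg_of_points K A B (pr2 _ _ \@ f).
  by move=> T a b; rewrite -!ccompA fM; exact: snE.
have pair1 T T' (x : pts T X) (u : coalgHom T' T) :
    cpair x (1 : pts T B) \@ u = cpair (ptcomp x u) (1 : pts T' B).
  by rewrite pair_comp -!/(ptcomp _ u) ptcomp1.
have pair2 T T' (b : pts T B) (u : coalgHom T' T) :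
    cpair (1 : pts T X) b \@ u = cpair (1 : pts T' X) (ptcomp b u).
  by rewrite pair_comp -!/(ptcomp _ u) ptcomp1.
pose k0 : coalgHom X' C := cpair (cidm X') (1 : pts X' B).
pose s0 : coalgHom (coalg_of B) C := cpair (1 : pts (coalg_of B) X) (cidm (coalg_of B)).
have k0E T (x : pts T X) : k0 \@ x = cpair x (1 : pts T B).
  by rewrite /k0 pair1; congr cpair; apply: ccomp1m.
have s0E T (b : pts T B) : s0 \@ b = cpair (1 : pts T X) b.
  by rewrite /s0 pair2; congr cpair; apply: ccomp1m.
have [|k kE] := @bialg_of_points K X A (g \@ k0).
  move=> T x y; apply: f_inj; rewrite fM -!ccompA !fgE !k0E.
  by apply: ext; rewrite !(fsE, snE) ?mulg1 // ptmap1 act_one.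
have [|s sE] := @bialg_of_points K B A (g \@ s0).
  move=> T x y; apply: f_inj; rewrite fM -!ccompA !fgE !s0E.
  by apply: ext; rewrite !(fsE, snE) // act_one_r mulg1.
have fk T (x : pts T X) : f \@ ptmap k x = cpair x (1 : pts T B).
  by rewrite kE -ccompA fgE k0E.
have fS T (b : pts T B) : f \@ ptmap s b = cpair (1 : pts T X) b.
  by rewrite sE -ccompA fgE s0E.
exists A, k, p, s; split.
- by apply: ptmap_inj => T b; rewrite ptmap_comp pE -ccompA fS ptmap_id; exact: snE.
- split=> [|Z z pz].
    by apply: ptmap_inj => T b; rewrite ptmap_comp pE -ccompA fk ptmap_zero; exact: snE.
  have fz T (a : pts T Z) : f \@ ptmap z a = cpair (fs T (f \@ ptmap z a)) (1 : pts T B).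
    apply: ext; rewrite ?fsE // snE.
    have := congr1 (fun z' => ptmap z' a) pz.
    by rewrite ptmap_comp ptmap_zero pE -ccompA.
  have [|u uE] := @bialg_of_points K Z X (pr1 _ _ \@ f \@ coalg_hom z).
    move=> T a b; rewrite -!ccompA -![coalg_hom z \@ _]/(ptmap z _) ptmapM fM.
    rewrite (fz _ a) (fz _ b).
    have -> : pr1 X' (coalg_of B) \@ mul T (cpair (fs T (f \@ ptmap z a)) (1 : pts T B))
      (cpair (fs T (f \@ ptmap z b)) (1 : pts T B)) =
      fs T (f \@ ptmap z a) * fs T (f \@ ptmap z b).
      by rewrite [LHS]fsE !(fsE, snE) ptmap1 act_one.
    by rewrite !pr1_pair.
  have ku T (a : pts T Z) : ptmap k (ptmap u a) = ptmap z a.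
    by apply: f_inj; rewrite fk fz uE -!ccompA.
  exists u; split; first by apply: ptmap_inj => T a; rewrite ptmap_comp ku.
  move=> u' ku'; apply: ptmap_inj => T a.
  have : ptmap k (ptmap u a) = ptmap k (ptmap u' a).
    by rewrite ku -ku' ptmap_comp.
  by move/(congr1 (fun b => fs T (f \@ b))); rewrite !fk !fsE.
- move=> T b x; apply: f_inj; rewrite !fM !fk !fS.
  apply: ext; rewrite !(fsE, snE) ?mul1g ?mulg1 //.
  by rewrite ptmap1 act_one mulg1.
Qed.

End Representation.

(** * Classification of split extensions *)

Section ActionRepresentability.
Variables (K : fieldType) (X R : cocHopf K).
Implicit Types (T : coalg K).
Local Open Scope group_scope.
Local Notation X' := (coalg_of X).
Variable F : coalgHom (tcoalg (coalg_of R) X') X'.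
Hypothesis actMr : forall T (r : pts T R) (x y : pts T X),
  app F r (x * y) = app F r x * app F r y.
Hypothesis actMl : forall T (r r' : pts T R) (x : pts T X),
  app F (r * r') x = app F r (app F r' x).
Hypothesis act_univ : forall T (F' G' : coalgHom (tcoalg T X') X'), aut F' G' ->
  exists r : pts T R, forall T' (u : coalgHom T' T) (x : pts T' X),
    app F (ptcomp r u) x = app F' u x.
Hypothesis act_faithful : forall T (r r' : pts T R),
  (forall T' (u : coalgHom T' T) (x : pts T' X),
    app F (ptcomp r u) x = app F (ptcomp r' u) x) -> r = r'.

Local Notation C := (Hopf_coc K).
Implicit Types B : cocHopf K.

Definition classified B (E : @split_ext C B X) (h : bialgHom B R) : Prop :=
  conj_action F (se_ker E) (se_sec E) h.

Lemma split_data_ex B (E : @split_ext C B X) :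
  exists th, @split_data K X (se_mid E) B (se_ker E) (se_proj E) (se_sec E) th.
Proof. exact: (split_dataP (se_split E) (se_kerP E)). Qed.

Lemma classified_ex B (E : @split_ext C B X) : exists h, classified E h.
Proof.
have [th dat] := split_data_ex E.
exact: (conj_action_ex actMl act_univ act_faithful dat).
Qed.

Lemma classified_uniq B (E : @split_ext C B X) h h' : classified E h -> classified E h' -> h = h'.
Proof. by have [th dat] := split_data_ex E; exact: (conj_action_uniq act_faithful dat). Qed.

Lemma classified_semidirect B (h : bialgHom B R) : exists E : @split_ext C B X, classified E h.
Proof.
have [A [k [p [s [ps kp hh]]]]] := semidirect actMr actMl act_univ act_faithful h.
by exists (@SplitExt C B X A k p s ps kp).
Qed.

(** Applying [t] to the conjugation relation of [E'] gives, in [E], conjugation by s (f b); the two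
    actions agree because the kernel inclusion is injective on points. *)
Lemma classified_pull B B' (f : bialgHom B' B) (E : @split_ext C B X)
    (E' : @split_ext C B' X) h :
  se_pullback (f : @Defs.hom C B' B) E E' -> classified E h -> classified E' (bialg_comp h f).
Proof.
move=> [t [_ tk ts]] hh; have [h' hh'] := classified_ex E'.
suff <- : h' = bialg_comp h f by [].
have [th dat] := split_data_ex E.
apply: ptmap_inj => T b; apply: act_faithful => T' u x.
rewrite !ptmap_ptcomp; apply: (split_k_inj dat).
have tkE (y : pts T' X) : ptmap t (ptmap (se_ker E') y) = ptmap (se_ker E) y.
  by rewrite -ptmap_comp; congr (ptmap _ _).
have tsE (y : pts T' B') : ptmap t (ptmap (se_sec E') y) = ptmap (se_sec E) (ptmap f y).
  by rewrite -!ptmap_comp; congr (ptmap _ _).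
apply: (mulIg (ptmap (se_sec E) (ptmap f (ptcomp b u)))).
rewrite -tkE -tsE -ptmapM -hh' ptmapM tkE tsE hh.
by rewrite ptmap_comp.
Qed.

(** The map [t] of [split_map] is the identity on the [X]-coordinate and [f] on the other, so the
    square is a pullback on points. *)
Lemma classified_pullback B B' (f : bialgHom B' B) (E : @split_ext C B X)
    (E' : @split_ext C B' X) h :
  classified E h -> classified E' (bialg_comp h f) -> se_pullback (f : @Defs.hom C B' B) E E'.
Proof.
move=> hh hh'; have [th dat] := split_data_ex E; have [th' dat'] := split_data_ex E'.
have [t tE] := split_map dat' hh hh'.
case: (dat) (dat') => [d1 d2 pk ps] [d1' d2' pk' ps'].
have ptE T (a : pts T (se_mid E')) :
    ptmap (se_proj E) (ptmap t a) = ptmap f (ptmap (se_proj E') a).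
  by rewrite tE ptmapM pk ps mul1g.
have t_inj T (c d : pts T (se_mid E')) : ptmap t c = ptmap t d ->
    ptmap (se_proj E') c = ptmap (se_proj E') d -> c = d.
  rewrite !tE => + pcd; rewrite pcd => /mulIg /(split_k_inj dat) thcd.
  by rewrite -[c]d1' -[d]d1' pcd thcd.
exists t; split; last 2 first.
- apply: ptmap_inj => T x; rewrite ptmap_comp tE pk' !ptmap1 mulg1.
  by have := d2' _ x 1; rewrite ptmap1 mulg1 => ->.
- apply: ptmap_inj => T b; rewrite !ptmap_comp tE ps'.
  by have := d2' _ 1 b; rewrite ptmap1 mul1g => ->; rewrite ptmap1 mul1g.
split=> [|Z a b pab]; first by apply: ptmap_inj => T x; rewrite !ptmap_comp ptE.
(* The mediating point has the [X]-coordinate of [a], and [b] as its other coordinate. *)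
pose u : pts (coalg_of Z) (se_mid E') :=
  ptmap (se_ker E') (th \@ coalg_hom a) * ptmap (se_sec E') (coalg_hom b).
have uE T (z : pts T Z) : u \@ z =
    ptmap (se_ker E') (th \@ ptmap a z) * ptmap (se_sec E') (ptmap b z).
  rewrite -/(ptcomp u z) ptcompM !ptmap_ptcomp.
  by congr (ptmap _ _ * _); apply: coalgHom_eq.
have pE T (z : pts T Z) : ptmap (se_proj E) (ptmap a z) = ptmap f (ptmap b z).
  by rewrite -!ptmap_comp; congr (ptmap _ _).
have puE T (z : pts T Z) : ptmap (se_proj E') (u \@ z) = ptmap b z.
  by rewrite uE ptmapM pk' ps' mul1g.
have tuE T (z : pts T Z) : ptmap t (u \@ z) = ptmap a z.
  by rewrite tE puE uE d2' -pE d1.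
have [|v vE] := @bialg_of_points K Z (se_mid E') u.
  by move=> T y z; apply: t_inj; rewrite !(tuE, puE, ptmapM).
exists v; split.
  by split; apply: ptmap_inj => T z; rewrite ptmap_comp vE ?tuE ?puE.
move=> w [tw pw]; apply: ptmap_inj => T z; apply: t_inj; rewrite vE ?tuE ?puE.
  by rewrite -ptmap_comp; congr (ptmap _ _).
by rewrite -ptmap_comp; congr (ptmap _ _).
Qed.

(** Both extensions are pullbacks of [E] along the identity. *)
Lemma classified_iso B (E E' : @split_ext C B X) h :
  classified E h -> classified E' h -> se_iso E E'.
Proof.
move=> hh hh'; apply: (se_pullback_uniq (f := @idm C B) (E := E)).
  exact: se_pullback_id (se_iso_refl E).
by apply: (classified_pullback hh); rewrite bialg_compm1.
Qed.

Lemma pullback_ex B B' (f : bialgHom B' B) (E : @split_ext C B X) :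
  exists E', se_pullback (f : @Defs.hom C B' B) E E'.
Proof.
have [h hh] := classified_ex E; have [E' hh'] := classified_semidirect (bialg_comp h f).
by exists E'; apply: classified_pullback hh hh'.
Qed.

Lemma SplExt_representable (pb : has_se_pullbacks C) :
  representable (SplExt_presheaf pb (X : C)).
Proof.
have ex_h (B : C) (c : SplExt B (X : C)) : exists h : bialgHom B R,
    forall E, c E -> classified E h.
  have [E cE] := SplExt_ex c; have [h hh] := classified_ex E; exists h => E' cE'.
  rewrite -[h]bialg_compm1; apply: (classified_pull _ hh).
  apply: se_pullback_id; exact/(SplExt_iso _ cE).
pose phi (B : C) (c : SplExt B (X : C)) : @Defs.hom C B R := sval (cid (ex_h B c)).
have phiP (B : C) (c : SplExt B (X : C)) E : c E -> classified E (phi B c).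
  exact: (svalP (cid (ex_h B c))).
exists (R : C), phi; split=> [B|B B' f c].
  (* The inverse sends a morphism to the class of its semidirect product; naturality of [phi] below
     is the behaviour of classifying maps under pullback. *)
  pose psi (h : bialgHom B R) := splext_class (sval (cid (classified_semidirect h))).
  have psiP (h : bialgHom B R) : classified (sval (cid (classified_semidirect h))) h.
    exact: (svalP (cid (classified_semidirect h))).
  exists psi => [c|h].
    have [E cE] := SplExt_ex c.
    have iE := classified_iso (psiP (phi B c)) (phiP _ _ _ cE).
    apply: SplExt_eq => E'; split=> [iE'|cE'].
      apply/(SplExt_iso _ cE); exact: se_iso_trans (se_iso_sym iE) iE'.
    apply: (se_iso_trans iE); exact/(SplExt_iso _ cE).
  by apply: (classified_uniq (phiP _ _ _ _) (psiP h)); exact: se_iso_refl.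
have [E cE] := SplExt_ex c; have [E' EE'] := pb _ _ _ f E.
apply: (classified_uniq (E := E')); last by apply: (classified_pull EE'); apply: phiP.
by apply: phiP; exists E.
Qed.

End ActionRepresentability.

Theorem corollary5p2 (K : fieldType) (char0 : [pchar K] =i pred0) :
  action_representable (Hopf_coc K).
Proof.
have pb : has_se_pullbacks (Hopf_coc K).
  move=> B B' X f E.
  have [R [F [Mr Ml univ faith]]] := automorphism_hopf X.
  exact: pullback_ex Mr Ml univ faith _ _ f E.
exists pb => X.
have [R [F [Mr Ml univ faith]]] := automorphism_hopf X.
exact: SplExt_representable Mr Ml univ faith pb.
Qed.
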